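(* Let $\Gamma$ be a Coxeter graph and let $\Gamma_1,\ldots,\Gamma_k$ be its connected components. Then there exists a group homomorphism $\Psi:\mathrm{Aut}(\mathrm{VA}[\Gamma])\to\mathfrak{S}_k$ such that, for every $\varphi\in\mathrm{Aut}(\mathrm{VA}[\Gamma])$ and every $i\in\{1,\ldots,k\}$, $$\varphi(\mathrm{VA}[\Gamma_i])=\mathrm{VA}[\Gamma_{\Psi(\varphi)(i)}].$$
   Context: A Coxeter matrix on a countable (finite or infinite) set $S$ is a symmetric matrix $(m_{s,t})_{s,t\in S}$ with $m_{s,s}=1$ for all $s$ and $m_{s,t}\in\{2,3,4,\dots\}\cup\{\infty\}$ for $s\neq t$. It is encoded by the Coxeter graph $\Gamma$: the simplicial graph with vertex set $S$ in which distinct $s,t$ are joined by an edge iff $m_{s,t}\ge 3$, the edge being labeled by $m_{s,t}$ when $m_{s,t}\geq 4$ (including $\infty$). The virtual Artin group $\mathrm{VA}[\Gamma]$ is the group with generators $\{\sigma_s : s\in S\}\cup\{\tau_s : s\in S\}$ and relations: (VA1) $\cdots\sigma_s\sigma_t\sigma_s=\cdots\sigma_t\sigma_s\sigma_t$ (alternating words, both sides with $m_{s,t}$ letters, the left one ending in $\sigma_s$, the right one ending in $\sigma_t$) for all $s\ne t$ with $m_{s,t}\neq\infty$; (VA2) $\cdots\tau_s\tau_t\tau_s=\cdots\tau_t\tau_s\tau_t$ (both sides with $m_{s,t}$ letters) for all $s\neq t$ with $m_{s,t}\ne\infty$, and $\tau_s^2=\mathrm{id}$ for all $s\in S$; (VA3)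 for all $s\ne t$ with $m_{s,t}\neq\infty$, $P\,\sigma_t=\sigma_r\,P$, where $P=\cdots\tau_s\tau_t\tau_s$ is the alternating word in $\tau_s,\tau_t$ with $m_{s,t}-1$ letters ending in $\tau_s$, and $r=t$ if $m_{s,t}$ is even, $r=s$ if $m_{s,t}$ is odd. If $\Gamma_1,\dots,\Gamma_k$ are the connected components of $\Gamma$, then $\mathrm{VA}[\Gamma]=\mathrm{VA}[\Gamma_1]\times\cdots\times\mathrm{VA}[\Gamma_k]$, where $\mathrm{VA}[\Gamma_i]$ is identified with the subgroup of $\mathrm{VA}[\Gamma]$ generated by the $\sigma_s,\tau_s$ with $s$ a vertex of $\Gamma_i$. $\mathfrak{S}_k$ is the symmetric group on $\{1,\dots,k\}$. *)

(* Defs.v *)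
From HB Require Import structures.
From mathcomp Require Import all_boot all_fingroup.
From mathcomp Require Import boolp classical_sets.

Set Implicit Arguments.
Unset Strict Implicit.
Unset Printing Implicit Defensive.

Local Open Scope classical_set_scope.
Local Open Scope group_scope.
Local Open Scope quotient_scope.

(* The letter (x, false) stands for the generator x, (x, true) for its
   inverse. *)
Definition word (X : Type) := seq (X * bool).

Definition letter (X : Type) (x : X) : X * bool := (x, false).

Definition word_inv (X : Type) (w : word X) : word X :=
  rev [seq (l.1, ~~ l.2) | l <- w].

Inductive pres_eq (X : Type) (R : word X -> word X -> Prop) :
    word X -> word X -> Prop :=
  | pres_rel u v : R u v -> pres_eq R u v
  | pres_cancel x b : pres_eq R [:: (x, b); (x, ~~ b)] [::]
  | pres_cat u u' v v' :
      pres_eq R u u' -> pres_eq R v v' -> pres_eq R (u ++ v) (u' ++ v')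
  | pres_refl u : pres_eq R u u
  | pres_sym u v : pres_eq R u v -> pres_eq R v u
  | pres_trans u v w : pres_eq R u v -> pres_eq R v w -> pres_eq R u w.

Definition pres_eqb (X : Type) (R : word X -> word X -> Prop)
  (u v : word X) : bool := `[< pres_eq R u v >].

Lemma pres_eqb_refl (X : Type) (R : word X -> word X -> Prop) :
  reflexive (pres_eqb R).
Proof. by move=> u; apply/asboolP; apply: pres_refl. Qed.

Lemma pres_eqb_sym (X : Type) (R : word X -> word X -> Prop) :
  symmetric (pres_eqb R).
Proof. by move=> u v; apply/asboolP/asboolP; apply: pres_sym. Qed.

Lemma pres_eqb_trans (X : Type) (R : word X -> word X -> Prop) :
  transitive (pres_eqb R).
Proof.
move=> v u w /asboolP uv /asboolP vw; apply/asboolP.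
exact: pres_trans uv vw.
Qed.

Canonical pres_equiv (X : Type) (R : word X -> word X -> Prop) :=
  EquivRel (pres_eqb R) (@pres_eqb_refl X R) (@pres_eqb_sym X R)
    (@pres_eqb_trans X R).

Definition presented (X : choiceType) (R : word X -> word X -> Prop) :=
  {eq_quot (pres_equiv R)}.

HB.instance Definition _ (X : choiceType) (R : word X -> word X -> Prop) :=
  Choice.on (presented R).

Definition pres_class (X : choiceType) (R : word X -> word X -> Prop)
  (w : word X) : presented R := \pi_({eq_quot (pres_equiv R)}) w.

Definition pres_repr (X : choiceType) (R : word X -> word X -> Prop)
  (g : presented R) : word X := generic_quotient.repr (g : {eq_quot (pres_equiv R)}).

Definition pres_one (X : choiceType) (R : word X -> word X -> Prop) :=
  pres_class R [::].

Definition pres_inv (X : choiceType) (R : word X -> word X -> Prop)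
  (g : presented R) := pres_class R (word_inv (pres_repr g)).

Definition pres_mul (X : choiceType) (R : word X -> word X -> Prop)
  (g h : presented R) := pres_class R (pres_repr g ++ pres_repr h).

Lemma pres_classP (X : choiceType) (R : word X -> word X -> Prop) u v :
  pres_class R u = pres_class R v <-> pres_eq R u v.
Proof.
split=> [/eqmodP/asboolP //|uv].
by apply/eqmodP/asboolP.
Qed.

Lemma pres_reprK (X : choiceType) (R : word X -> word X -> Prop) :
  cancel (@pres_repr X R) (pres_class R).
Proof. exact: reprK. Qed.

Lemma pres_repr_class (X : choiceType) (R : word X -> word X -> Prop) w :
  pres_eq R (pres_repr (pres_class R w)) w.
Proof. by apply/pres_classP; rewrite pres_reprK. Qed.

Lemma pres_inv_cat (X : Type) (R : word X -> word X -> Prop) w :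
  pres_eq R (word_inv w ++ w) [::].
Proof.
elim: w => [|[x b] w IH]; first exact: pres_refl.
rewrite /word_inv /= rev_cons -cats1 -catA /=.
apply: pres_trans IH; apply: pres_cat; first exact: pres_refl.
apply: (@pres_cat _ _ [:: (x, ~~ b); (x, b)] [::]); last exact: pres_refl.
by have := @pres_cancel X R x (~~ b); rewrite negbK.
Qed.

Lemma word_invK (X : Type) : involutive (@word_inv X).
Proof.
move=> w; rewrite /word_inv map_rev revK -map_comp -[RHS]map_id.
by apply: eq_map => -[x b] /=; rewrite negbK.
Qed.

Lemma pres_mulA (X : choiceType) (R : word X -> word X -> Prop) :
  associative (@pres_mul X R).
Proof.
move=> f g h; apply/pres_classP.
apply: (@pres_trans _ _ _ (pres_repr f ++ (pres_repr g ++ pres_repr h))).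
  by apply: pres_cat; [exact: pres_refl|exact: pres_repr_class].
rewrite catA; apply: pres_cat; last exact: pres_refl.
by apply: pres_sym; exact: pres_repr_class.
Qed.

Lemma pres_mul1 (X : choiceType) (R : word X -> word X -> Prop) :
  left_id (pres_one R) (@pres_mul X R).
Proof.
move=> g; rewrite -[RHS]pres_reprK; apply/pres_classP.
apply: (@pres_cat _ _ _ [::]); last exact: pres_refl.
exact: pres_repr_class.
Qed.

Lemma pres_mulr1 (X : choiceType) (R : word X -> word X -> Prop) :
  right_id (pres_one R) (@pres_mul X R).
Proof.
move=> g; rewrite -[RHS]pres_reprK; apply/pres_classP.
rewrite -[X in pres_eq _ _ X]cats0.
by apply: pres_cat; [exact: pres_refl|exact: pres_repr_class].
Qed.

Lemma pres_mulV (X : choiceType) (R : word X -> word X -> Prop) :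
  left_inverse (pres_one R) (@pres_inv X R) (@pres_mul X R).
Proof.
move=> g; apply/pres_classP; apply: pres_trans (pres_inv_cat R (pres_repr g)).
by apply: pres_cat; [exact: pres_repr_class|exact: pres_refl].
Qed.

Lemma pres_mulrV (X : choiceType) (R : word X -> word X -> Prop) :
  right_inverse (pres_one R) (@pres_inv X R) (@pres_mul X R).
Proof.
move=> g; apply/pres_classP.
apply: pres_trans (pres_inv_cat R (word_inv (pres_repr g))).
rewrite word_invK.
by apply: pres_cat; [exact: pres_refl|exact: pres_repr_class].
Qed.

HB.instance Definition _ (X : choiceType) (R : word X -> word X -> Prop) :=
  isGroup.Build (presented R) (@pres_mulA X R) (@pres_mul1 X R)
    (@pres_mulr1 X R) (@pres_mulV X R) (@pres_mulrV X R).

Definition is_subgroup (G : groupType) (H : set G) : Prop :=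
  [/\ H 1, forall x y, H x -> H y -> H (x * y) & forall x, H x -> H x^-1].

Definition gen_subgroup (G : groupType) (A : set G) : set G :=
  smallest (@is_subgroup G) A.

Record group_aut (G : groupType) := Aut_of {
  aut_fun :> {multiplicative G -> G};
  aut_bij : bijective aut_fun
}.

HB.instance Definition _ (G : groupType) := gen_eqMixin (group_aut G).
HB.instance Definition _ (G : groupType) := gen_choiceMixin (group_aut G).

Lemma aut_eqP (G : groupType) (f g : group_aut G) : f =1 g -> f = g.
Proof.
case: f g => [[f [[mf]]] bf] [[g [[mg]]] bg] /= /funext fg.
case: _ / fg mg bg => mg bg.
by rewrite (Prop_irrelevance mg mf) (Prop_irrelevance bg bf).
Qed.

Lemma aut_id_bij (G : groupType) : bijective (idfun : G -> G).
Proof. by exists idfun. Qed.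

Definition aut_one (G : groupType) : group_aut G := Aut_of (aut_id_bij G).

(* Same convention as for permutations in MathComp, where (s * t) x = t (s x):
   the product f * g is "first f, then g". *)
Definition aut_mul (G : groupType) (f g : group_aut G) : group_aut G :=
  @Aut_of G (g \o f) (bij_comp (aut_bij g) (aut_bij f)).

Lemma aut_inv_subproof (G : groupType) (f : group_aut G) :
  exists g : group_aut G, cancel f g /\ cancel g f.
Proof.
have [g fK gK] := aut_bij f.
have gM : {morph g : x y / x * y}.
  by move=> x y; rewrite -{1}[x]gK -{1}[y]gK -gmulfM fK.
pose gm : {multiplicative G -> G} :=
  HB.pack g (isMultiplicative.Build G G g gM).
have gb : bijective gm by exists f.
by exists (Aut_of gb).
Qed.

Definition aut_inv (G : groupType) (f : group_aut G) : group_aut G :=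
  projT1 (cid (aut_inv_subproof f)).

Lemma aut_mulA (G : groupType) : associative (@aut_mul G).
Proof. by move=> f g h; apply: aut_eqP. Qed.

Lemma aut_mul1 (G : groupType) : left_id (aut_one G) (@aut_mul G).
Proof. by move=> f; apply: aut_eqP. Qed.

Lemma aut_mulr1 (G : groupType) : right_id (aut_one G) (@aut_mul G).
Proof. by move=> f; apply: aut_eqP. Qed.

Lemma aut_mulV (G : groupType) :
  left_inverse (aut_one G) (@aut_inv G) (@aut_mul G).
Proof.
by move=> f; apply: aut_eqP => x; rewrite /aut_inv; case: cid => g [? gK] /=.
Qed.

Lemma aut_mulrV (G : groupType) :
  right_inverse (aut_one G) (@aut_inv G) (@aut_mul G).
Proof.
by move=> f; apply: aut_eqP => x; rewrite /aut_inv; case: cid => g [fK ?] /=.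
Qed.

HB.instance Definition _ (G : groupType) :=
  isGroup.Build (group_aut G) (@aut_mulA G) (@aut_mul1 G) (@aut_mulr1 G)
    (@aut_mulV G) (@aut_mulrV G).

(* [None] encodes the label infinity. *)
Record coxeter_matrix (S : countType) := CoxeterMatrix {
  cox_m :> S -> S -> option nat;
  cox_sym : forall s t, cox_m s t = cox_m t s;
  cox_diag : forall s, cox_m s s = Some 1%N;
  cox_off : forall s t m, s != t -> cox_m s t = Some m -> (2 <= m)%N
}.

Definition cox_edge (S : countType) (M : coxeter_matrix S) : rel S :=
  fun s t => (s != t) && (if M s t is Some m then 3 <= m else true)%N.

Definition component (S : countType) (M : coxeter_matrix S) (s : S) : set S :=
  [set t | exists2 p, path (cox_edge M) s p & t = last s p].

(* Components are given by their vertex sets; each is listed exactly once. *)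
Definition connected_components (S : countType) (M : coxeter_matrix S)
    (k : nat) (Gam : 'I_k -> set S) : Prop :=
  injective Gam /\ range Gam = range (component M).

(* [inl s] is sigma_s and [inr s] is tau_s. *)
Definition va_gen (S : countType) : countType := (S + S)%type.

Definition sigma_l (S : countType) (s : S) : va_gen S * bool :=
  letter (inl s : va_gen S).

Definition tau_l (S : countType) (s : S) : va_gen S * bool :=
  letter (inr s : va_gen S).

(* The alternating word  ... b a b a  with n letters, ending in a. *)
Fixpoint alt (L : Type) (a b : L) (n : nat) : seq L :=
  if n is n'.+1 then rcons (alt b a n') a else [::].

Inductive va_rel (S : countType) (M : coxeter_matrix S) :
    word (va_gen S) -> word (va_gen S) -> Prop :=
  | VA1 s t m : s != t -> M s t = Some m ->
      va_rel M (alt (sigma_l s) (sigma_l t) m) (alt (sigma_l t) (sigma_l s) m)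
  | VA2 s t m : s != t -> M s t = Some m ->
      va_rel M (alt (tau_l s) (tau_l t) m) (alt (tau_l t) (tau_l s) m)
  | VA2_sq s : va_rel M [:: tau_l s; tau_l s] [::]
  | VA3 s t m : s != t -> M s t = Some m ->
      va_rel M (rcons (alt (tau_l s) (tau_l t) m.-1) (sigma_l t))
        (sigma_l (if odd m then s else t) :: alt (tau_l s) (tau_l t) m.-1).

Definition VA (S : countType) (M : coxeter_matrix S) : groupType :=
  presented (va_rel M).

Definition sigma (S : countType) (M : coxeter_matrix S) (s : S) : VA M :=
  pres_class (va_rel M) [:: sigma_l s].

Definition tau (S : countType) (M : coxeter_matrix S) (s : S) : VA M :=
  pres_class (va_rel M) [:: tau_l s].

(* VA[Gamma'], for the full subgraph Gamma' with vertex set A, as a subgroup of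
   VA[Gamma]. *)
Definition VA_sub (S : countType) (M : coxeter_matrix S) (A : set S) :
    set (VA M) :=
  gen_subgroup (sigma M @` A `|` tau M @` A).

Arguments VA_sub {S} M A.

(* Main.v *)
(* Let K be the kernel of the retraction of VA[Gamma] onto the Coxeter group W
   generated by the tau_s (sigma_s is sent to 1).  The presentation shows that
   VA[Gamma] is the semidirect product of K by W and that K is an Artin group on
   the roots w alpha_s, two distinct roots having a finite label only if they are
   of the form w alpha_s, w alpha_t; in particular opposite roots b, -b have label
   infinity.

   Whenever the generators b, c of an Artin group have label infinity, the group
   is the amalgamated product of the subgroups generated by all generators but b,
   respectively all but c, over their intersection.  With the theorem that
   parabolic subgroups intersect in parabolic subgroups, normal forms for these
   amalgams give:
   - the centralizer of K in VA[Gamma] is trivial;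
   - two normal subgroups of K that both contain a nontrivial element supported on
     the roots of the same component Gamma_i do not commute: commuting normal
     subgroups cannot both escape the amalgamated subgroup of one amalgam, and the
     graph of infinite labels on the roots of Gamma_i is connected.
   The images phi(VA[Gamma_j]) are normal and commute with each other, so exactly
   one of them has a nontrivial projection to VA[Gamma_i]; as the centralizers of
   the factors are the complementary factors, this one is VA[Gamma_i]. *)
From HB Require Import structures.
Require Import Defs.
From mathcomp Require Import all_boot all_fingroup.
From mathcomp Require Import all_order all_algebra all_field ring.
From mathcomp Require Import boolp classical_sets.

Set Implicit Arguments.
Unset Strict Implicit.
Unset Printing Implicit Defensive.

Local Open Scope classical_set_scope.
Local Open Scope group_scope.

(** * Presented groups and alternating words *)

(** Labels on roots make sense only if every product of two simple reflections has exactly the order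
    prescribed by the matrix. This is the one place where linear algebra enters: W acts on functions
    from the generators to the algebraic numbers, and only the values at two generators have to be
    followed. Signs of roots come instead from a parity attached to words in W, so no positivity of
    a form is involved. The theorem on parabolic intersections rests on a retraction of an Artin
    group onto a parabolic subgroup that is in general no homomorphism. A word is followed through
    minimal coset representatives, and each braid relation is checked on one dihedral orbit. The
    presentation of K is not obtained by rewriting: the Artin group on the roots maps to VA[Gamma],
    and VA[Gamma] acts back on it, which proves injectivity. An element centralizing K need not lie
    in K a priori. Its component in W is removed first, because an element of the Artin group cannot
    conjugate both members of a pair b, -b away from themselves. *)

Section GroupMorphism.
Variables (G H : groupType) (f : G -> H).
Hypothesis fM : {morph f : x y / x * y}.

Lemma morph_group1 : f 1 = 1.
Proof. by apply: (mulgI (f 1)); rewrite -fM !mulg1. Qed.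

Lemma morph_groupV : {morph f : x / x^-1}.
Proof. by move=> x; apply/esym/mulg1_eq; rewrite -fM mulgV morph_group1. Qed.

Lemma morph_groupJ : {morph f : x y / x ^ y}.
Proof. by move=> x y; rewrite !conjgE !fM morph_groupV. Qed.

End GroupMorphism.

Section Presented.
Variables (X : choiceType) (R : word X -> word X -> Prop).

Definition gen (x : X) : presented R := pres_class R [:: letter x].

Lemma pres_classM u v :
  pres_class R (u ++ v) = pres_class R u * pres_class R v.
Proof.
apply/pres_classP; apply: pres_cat; apply: pres_sym; exact: pres_repr_class.
Qed.

Lemma pres_class_inv x : pres_class R [:: (x, true)] = (gen x)^-1.
Proof.
apply/esym/mulg1_eq; rewrite /gen -pres_classM /=; apply/pres_classP.
exact: (@pres_cancel X R x false).
Qed.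

Definition letter_val (H : groupType) (f : X -> H) (l : X * bool) : H :=
  if l.2 then (f l.1)^-1 else f l.1.

Definition word_val (H : groupType) (f : X -> H) (u : word X) : H :=
  foldr (fun l h => letter_val f l * h) 1 u.

Lemma word_val_cat (H : groupType) (f : X -> H) u v :
  word_val f (u ++ v) = word_val f u * word_val f v.
Proof. by elim: u => [|l u IH] /=; rewrite ?mul1g // IH mulgA. Qed.

Lemma word_val_gen u : word_val gen u = pres_class R u.
Proof.
elim: u => [|[x b] u IH] //=; rewrite IH -cat1s pres_classM /letter_val /=.
by case: b => //; rewrite pres_class_inv.
Qed.

Lemma pres_class_surj (g : presented R) : exists u, g = pres_class R u.
Proof. by exists (pres_repr g); rewrite pres_reprK. Qed.

Lemma word_val_pres (H : groupType) (f : X -> H) :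
  (forall u v, R u v -> word_val f u = word_val f v) ->
  forall u v, pres_eq R u v -> word_val f u = word_val f v.
Proof.
move=> fR u v; elim=> {u v} //= [x b|u u' v v' _ IHu _ IHv|u v w _ -> _ ->] //.
  by rewrite /letter_val mulg1; case: b; rewrite /= ?mulVg ?mulgV.
by rewrite !word_val_cat IHu IHv.
Qed.

Section Hom.
Variables (H : groupType) (f : X -> H).
Hypothesis fR : forall u v, R u v -> word_val f u = word_val f v.

Definition pres_hom of (forall u v, R u v -> word_val f u = word_val f v) :=
  fun g : presented R => word_val f (pres_repr g).

Lemma pres_hom_class u : pres_hom fR (pres_class R u) = word_val f u.
Proof. exact/(word_val_pres fR)/pres_repr_class. Qed.

Lemma pres_homM : {morph pres_hom fR : g h / g * h}.
Proof.
move=> g h; have [u ->] := pres_class_surj g.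
have [v ->] := pres_class_surj h.
by rewrite -pres_classM !pres_hom_class word_val_cat.
Qed.

Lemma pres_hom_gen x : pres_hom fR (gen x) = f x.
Proof. by rewrite pres_hom_class /= mulg1. Qed.

End Hom.

(** The letters act by total functions, but the relations are required only on the states satisfying
    [V], such as minimal coset representatives or normal forms. *)
Lemma pres_act (Om : Type) (V : Om -> Prop) (f : X * bool -> Om -> Om) :
  (forall l o, V o -> V (f l o)) ->
  (forall x b o, V o -> f (x, b) (f (x, ~~ b) o) = o) ->
  (forall u v, R u v -> forall o, V o -> foldr f o u = foldr f o v) ->
  forall u v, pres_eq R u v -> forall o, V o -> foldr f o u = foldr f o v.
Proof.
move=> fV fK fR u v; elim=> {u v} //=.
- move=> u u' v v' _ IHu _ IHv o Vo; rewrite !foldr_cat IHv // IHu //.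
  by elim: v' {IHv} => //= l v' IH; apply: fV.
- by move=> u v _ IH o Vo; rewrite IH.
- by move=> u v w _ IH _ IH' o Vo; rewrite IH // IH'.
Qed.

Lemma pres_ind (Q : presented R -> Prop) :
  Q 1 -> (forall x g, Q g -> Q (gen x * g)) ->
  (forall x g, Q g -> Q ((gen x)^-1 * g)) -> forall g, Q g.
Proof.
move=> Q1 Qg QV g; have [u ->] := pres_class_surj g.
rewrite -word_val_gen; elim: u => [|[x []] u IH] //=; [exact: QV|exact: Qg].
Qed.

Lemma pres_hom_ext (H : groupType) (f g : presented R -> H) :
  {morph f : x y / x * y} -> {morph g : x y / x * y} ->
  (forall x, f (gen x) = g (gen x)) -> f =1 g.
Proof.
move=> fM gM fg; apply: pres_ind => [|x h IH|x h IH].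
- by rewrite !morph_group1.
- by rewrite fM gM IH fg.
- by rewrite fM gM IH !morph_groupV // fg.
Qed.

End Presented.

(* The alternating word [a b a ...] with [n] letters, starting with [a];
   compare [alt a b n], which ends in [a]. *)
Fixpoint altl (L : Type) (a b : L) (n : nat) : seq L :=
  if n is n'.+1 then a :: altl b a n' else [::].

Lemma altl_rcons (L : Type) (a b : L) n :
  altl a b n.+1 = rcons (altl a b n) (if odd n then b else a).
Proof.
elim: n a b => [|n IH] a b //.
by rewrite -[LHS]/(a :: altl b a n.+1) IH /= if_neg.
Qed.

Lemma altE (L : Type) (a b : L) n :
  alt a b n = if odd n then altl a b n else altl b a n.
Proof.
elim: n a b => [|n IH] a b //.
rewrite [LHS]/= IH !altl_rcons /=; by case: (odd n).
Qed.

Lemma map_alt (L L' : Type) (f : L -> L') a b n :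
  map f (alt a b n) = alt (f a) (f b) n.
Proof. by elim: n a b => //= n IH a b; rewrite map_rcons IH. Qed.

Lemma map_altl (L L' : Type) (f : L -> L') a b n :
  map f (altl a b n) = altl (f a) (f b) n.
Proof. by elim: n a b => //= n IH a b; rewrite IH. Qed.

Lemma alt_foldr (L T : Type) (f : L -> T -> T) (o : T) a b n :
  foldr f o (alt a b n.+1) = foldr f (f a o) (alt b a n).
Proof. by rewrite /= -cats1 foldr_cat. Qed.

Fixpoint galt (G : groupType) (x y : G) (n : nat) : G :=
  if n is n'.+1 then x * galt y x n' else 1.

Lemma word_val_altl (X : choiceType) (G : groupType) (f : X -> G) a b n :
  word_val f (altl (letter a) (letter b) n) = galt (f a) (f b) n.
Proof. by elim: n a b => //= n IH a b; rewrite IH. Qed.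

Lemma galtJ (G : groupType) (x y z : G) n :
  galt x y n ^ z = galt (x ^ z) (y ^ z) n.
Proof. by elim: n x y => [|n IH] x y /=; rewrite ?conj1g // conjMg IH. Qed.

Lemma word_val_alt_eq (X : choiceType) (G : groupType) (f : X -> G) a b n :
  word_val f (alt (letter a) (letter b) n)
    = word_val f (alt (letter b) (letter a) n) <->
  galt (f a) (f b) n = galt (f b) (f a) n.
Proof. by rewrite !altE; case: odd; rewrite !word_val_altl; split=> ->. Qed.

Section Involutions.
Variables (G : groupType) (x y : G).
Hypotheses (xx : x * x = 1) (yy : y * y = 1).

Lemma galt_divg n : galt x y n * (galt y x n)^-1 = (x * y) ^+ n.
Proof.
have invx : x^-1 = x by apply: mulg1_eq.
have invy : y^-1 = y by apply: mulg1_eq.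
have E k : (galt x y k * (galt y x k)^-1 = (x * y) ^+ k) /\
           (galt y x k * (galt x y k)^-1 = (y * x) ^+ k).
  elim: k => [|k [IH1 IH2]] /=; first by rewrite expg0 mulgV.
  rewrite !invgM invx invy.
  have e (a b : G) : a * (b * a) ^+ k * b = (a * b) ^+ k.+1.
    elim: k {IH1 IH2} => [|k IH]; first by rewrite expg0 mulg1 expg1.
    by rewrite expgS [RHS]expgS -IH !mulgA.
  by rewrite -!mulgA [galt y x k * _]mulgA [galt x y k * (_ * _)]mulgA IH1 IH2 !mulgA !e.
by have [] := E n.
Qed.

Lemma galt_eq n : galt x y n = galt y x n <-> (x * y) ^+ n = 1.
Proof.
rewrite -galt_divg; split=> [->|]; first by rewrite mulgV.
exact: divg1_eq.
Qed.

Lemma galt_double n : galt x y n.*2 = (x * y) ^+ n.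
Proof. by elim: n => // n IH; rewrite doubleS expgS -IH /= mulgA. Qed.

End Involutions.

(** * The order of a product of two generators of a Coxeter group *)

Section Relations.
Variables (I : choiceType) (m : I -> I -> option nat).

Inductive artin_rel : word I -> word I -> Prop :=
  | Artin_braid s t k : s != t -> m s t = Some k ->
      artin_rel (alt (letter s) (letter t) k) (alt (letter t) (letter s) k).

Inductive cox_rel : word I -> word I -> Prop :=
  | Cox_braid s t k : s != t -> m s t = Some k ->
      cox_rel (alt (letter s) (letter t) k) (alt (letter t) (letter s) k)
  | Cox_sq s : cox_rel [:: letter s; letter s] [::].

Definition artin : groupType := presented artin_rel.
Definition cox : groupType := presented cox_rel.

Definition sgen (s : I) : artin := gen artin_rel s.
Definition rgen (s : I) : cox := gen cox_rel s.

Lemma sgen_braid s t k : s != t -> m s t = Some k ->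
  galt (sgen s) (sgen t) k = galt (sgen t) (sgen s) k.
Proof.
move=> st mst; apply/word_val_alt_eq; rewrite !word_val_gen.
by apply/pres_classP/pres_rel; constructor.
Qed.

Lemma rgen_braid s t k : s != t -> m s t = Some k ->
  galt (rgen s) (rgen t) k = galt (rgen t) (rgen s) k.
Proof.
move=> st mst; apply/word_val_alt_eq; rewrite !word_val_gen.
by apply/pres_classP/pres_rel; constructor.
Qed.

Lemma rgen_sq s : rgen s * rgen s = 1.
Proof. by rewrite -pres_classM; apply/pres_classP/pres_rel; constructor. Qed.

Lemma rgenV s : (rgen s)^-1 = rgen s.
Proof. by apply: mulg1_eq; exact: rgen_sq. Qed.

Lemma rgen_expg s t k : s != t -> m s t = Some k ->
  (rgen s * rgen t) ^+ k = 1.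
Proof. by move=> st mst; apply/galt_eq; [exact: rgen_sq|exact: rgen_sq|exact: rgen_braid]. Qed.

End Relations.

Section LinearRep.
Import Order.TTheory GRing.Theory Num.Theory.
Local Open Scope ring_scope.
Variables (I : choiceType) (m : I -> I -> option nat).
Hypothesis m_sym : forall s t, m s t = m t s.
Hypothesis m_gt1 : forall s t k, s != t -> m s t = Some k -> (1 < k)%N.

(* [z] is a primitive root of unity of order [2 m], so that [z + z^-1] plays the
   role of [2 cos (pi / m)]; for [m] infinite, any [z] of infinite order. *)
Definition cox_root_spec (o : option nat) (z : algC) : Prop :=
  if o is Some k then (1 < k)%N -> k.*2.-primitive_root z
  else z != 0 /\ forall n, z ^+ n = 1 -> n = 0%N.

Lemma cox_root_subproof o : exists z, cox_root_spec o z.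
Proof.
case: o => [k|] /=.
  have [lt1k|] := ltnP 1 k; last by exists 0.
  have k0 : (0 < k.*2)%N by rewrite double_gt0 ltnW.
  by have [z zP] := C_prim_root_exists k0; exists z.
(* For the label infinity, 2 has infinite order: its positive powers are even. *)
exists 2; split=> [|n]; first by rewrite pnatr_eq0.
rewrite -natrX => /eqP; rewrite -[1]/(1%:R) eqr_nat => /eqP.
by case: n => // n; rewrite expnS mul2n => e; have := odd_double (2 ^ n); rewrite e.
Qed.

Definition cox_root o : algC := projT1 (cid (cox_root_subproof o)).

(** The value -1 of the m-th power yields the braid relation, and the order of the square of the
    root yields the exact order of the product of two reflections. *)
Lemma cox_rootP s t : s != t ->
  [/\ cox_root (m s t) != 0, cox_root (m s t) ^+ 2 != 1,
      (forall k, m s t = Some k -> cox_root (m s t) ^+ k = -1) &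
      (forall n, cox_root (m s t) ^+ n.*2 = 1 ->
         exists2 k, m s t = Some k & (k %| n)%N) \/
      (forall n, cox_root (m s t) ^+ n.*2 = 1 -> n = 0%N)].
Proof.
rewrite /cox_root; case: cid => z /= + st.
case E: (m s t) => [k|] /=.
  have k1 := m_gt1 st E => /(_ k1) zP.
  have z2 : z ^+ 2 != 1.
    rewrite -(prim_order_dvd zP); apply/negP => /dvdn_leq -/(_ isT).
    by rewrite -[2%N]/(1.*2) leq_double leqNgt k1.
  split=> //.
  - apply/eqP => z0; have := prim_expr_order zP.
    by rewrite z0 expr0n double_eq0 gtn_eqF ?(ltnW k1) // => /esym/eqP; rewrite oner_eq0.
  - move=> _ [<-].
    have := prim_expr_order zP; rewrite -muln2 exprM => /eqP.
    rewrite sqrf_eq1 => /orP[|/eqP //].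
    rewrite -(prim_order_dvd zP) -muln2 => /dvdn_leq.
    by rewrite (ltnW k1) => /(_ isT); rewrite muln2 -addnn -{3}[k]addn0 leq_add2l leqNgt (ltnW k1).
  - left=> n /eqP; rewrite -(prim_order_dvd zP) => kn; exists k => //.
    by move: kn; rewrite -!muln2 dvdn_pmul2r.
case=> z0 zP; split=> //.
- by apply/eqP => /zP.
- by right => n /zP /eqP; rewrite double_eq0 => /eqP.
Qed.

(** This is -2 B(alpha_s, alpha_t) for a symmetric form with B(alpha_s, alpha_s) = 1. For a finite
    label an arbitrary primitive root gives 2 cos(j pi / m) with j prime to 2m, which leaves the
    orders of products of two reflections unchanged. *)
Definition cox_coef s t : algC :=
  if s == t then -2 else cox_root (m s t) + (cox_root (m s t))^-1.

(* The dual of the geometric representation: the reflection of [s] acts on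
   linear forms, given by their values on the simple roots. *)
Definition cox_step (s : I) (f : I -> algC) : I -> algC :=
  fun u => f u + cox_coef s u * f s.

Lemma cox_stepK s f : cox_step s (cox_step s f) = f.
Proof.
by apply/funext => u; rewrite /cox_step {3}/cox_coef eqxx; ring.
Qed.

Lemma cox_coef_sym s t : cox_coef s t = cox_coef t s.
Proof. by rewrite /cox_coef m_sym eq_sym. Qed.

Lemma cox_step_span a b l f : all [pred x | (x == a) || (x == b)] l ->
  exists A B, forall u,
    foldr cox_step f l u = f u + cox_coef a u * A + cox_coef b u * B.
Proof.
elim: l => [_|x l IH /= /andP[/orP xab /IH[A [B E]]]].
  by exists 0, 0 => u; rewrite !mulr0 !addr0.
set F := foldr _ _ _ in E *.
case: xab => /eqP ->.
  by exists (A + F a), B => u; rewrite /cox_step E; ring.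
by exists A, (B + F b) => u; rewrite /cox_step E; ring.
Qed.

(** The values met along the alternating word satisfy x_{n+1} = (z + 1/z) x_n - x_{n-1}, whose
    solutions are al z^n + be z^-n. The initial data are x_0 = [f a] and x_{-1} = [- f b]. *)
Lemma cox_step_alt a b z f (al be : algC) k : a != b -> z != 0 ->
  cox_coef a b = z + z^-1 ->
  f a = al + be -> f b = - (al / z + be * z) ->
  let F := foldr cox_step f (alt a b k) in
  F (if odd k then b else a) = al * z ^+ k + be / z ^+ k /\
  F (if odd k then a else b) = - (al * z ^+ k / z + be / z ^+ k * z).
Proof.
elim: k a b f al be => [|k IH] a b f al be ab z0 cab fa fb F.
  by rewrite /F /= fa fb; split; field.
rewrite {}/F alt_foldr /=.
have ga : cox_step a f a = - (al + be).
  by rewrite /cox_step /cox_coef eqxx fa; ring.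
have gb : cox_step a f b = al * z + be / z.
  by rewrite /cox_step cab fa fb; field.
have ba : b != a by rewrite eq_sym.
have := IH b a (cox_step a f) (al * z) (be / z) ba z0.
rewrite cox_coef_sym => /(_ cab gb) [].
  by rewrite ga; field.
rewrite !if_neg => -> ->; split; rewrite ?exprS; field; rewrite ?expf_neq0 //.
Qed.

(** Since z^k = -1, either alternating word negates the values at [s] and [t], exchanging them when
    [k] is odd. Both words thus agree at [s] and [t], and by [cox_step_span] these two values
    determine all others. *)
Lemma cox_step_braid s t k : s != t -> m s t = Some k ->
  forall f, foldr cox_step f (alt s t k) = foldr cox_step f (alt t s k).
Proof.
move=> st mst f.
have [z0 z2 /(_ _ mst) zk _] := cox_rootP st.
set z := cox_root (m s t) in z0 z2 zk.
have cst : cox_coef s t = z + z^-1 by rewrite /cox_coef (negPf st).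
have zz : z * z - 1 != 0 by rewrite subr_eq0 -expr2.
have sol p q : exists al be, p = al + be /\ q = - (al / z + be * z).
  exists (p + (q * z + p) / (z * z - 1)), (- (q * z + p) / (z * z - 1)).
  by split; field; rewrite ?z0 ?zz.
have E a b : a != b -> cox_coef a b = z + z^-1 ->
    let F := foldr cox_step f (alt a b k) in
    F (if odd k then b else a) = - f a /\ F (if odd k then a else b) = - f b.
  move=> ab cab /=; have [al [be [fa fb]]] := sol (f a) (f b).
  have /= [-> ->] := cox_step_alt k ab z0 cab fa fb.
  by rewrite zk fa fb; split; field.
have ts : t != s by rewrite eq_sym.
have := E s t st cst; have := E t s ts; rewrite cox_coef_sym => /(_ cst).
have span a b : (a == s) || (a == t) -> (b == s) || (b == t) -> exists A B, forall u,
    foldr cox_step f (alt a b k) u = f u + cox_coef s u * A + cox_coef t u * B.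
  move=> ha hb; apply: cox_step_span; elim: k a b ha hb {mst zk E} => //= n IH a b ha hb.
  by rewrite all_rcons /= ha IH.
have [|| A [B EA]] := span s t; rewrite ?eqxx ?orbT //.
have [|| A' [B' EA']] := span t s; rewrite ?eqxx ?orbT //.
move=> /= [Ft Ft'] [Fs Fs'].
have [es et] : foldr cox_step f (alt s t k) s = foldr cox_step f (alt t s k) s /\
               foldr cox_step f (alt s t k) t = foldr cox_step f (alt t s k) t.
  by case: odd Ft Ft' Fs Fs' => -> -> -> ->.
have css x : cox_coef x x = -2 by rewrite /cox_coef eqxx.
move: es et; rewrite !EA !EA' !css (cox_coef_sym t s) cst => es et.
(* Up to sign, the determinant of the matrix with diagonal entries -2 and off-diagonal entries z +
   1/z, which determines [A] and [B]. *)
have d : (z - z^-1) ^+ 2 != 0.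
  have -> : z - z^-1 = (z * z - 1) / z by field.
  by rewrite expf_neq0 // mulf_neq0 ?invr_eq0.
have eA : A = A'.
  apply/eqP; rewrite -subr_eq0; apply/eqP/(mulfI d); rewrite mulr0.
  transitivity (2 * (f s + - 2 * A + (z + z^-1) * B - (f s + - 2 * A' + (z + z^-1) * B'))
    + (z + z^-1) * (f t + (z + z^-1) * A + - 2 * B - (f t + (z + z^-1) * A' + - 2 * B'))).
    by field.
  by rewrite es et; ring.
have eB : B = B'.
  apply: (@mulfI _ (- 2)); first by rewrite oppr_eq0 pnatr_eq0.
  by apply: (@addrI _ (f t + (z + z^-1) * A)); rewrite et eA.
by apply/funext => u; rewrite EA EA' eA eB.
Qed.

Lemma cox_step_pres (u v : word I) : pres_eq (cox_rel m) u v ->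
  forall f, foldr (fun l => cox_step l.1) f u = foldr (fun l => cox_step l.1) f v.
Proof.
move=> uv f; apply: (pres_act (V := fun=> True) _ _ _ uv) => // [x b o _|].
  exact: cox_stepK.
move=> {u v uv f} u v [s t k st mst|s] f _; last exact: cox_stepK.
have E (w : word I) : foldr (fun l => cox_step l.1) f w = foldr cox_step f (map fst w).
  by rewrite foldr_map.
by rewrite !E !map_alt; exact: cox_step_braid.
Qed.

Lemma rgen_order s t n : s != t -> ((rgen m s * rgen m t) ^+ n = 1)%g ->
  n = 0%N \/ exists2 k, m s t = Some k & (k %| n)%N.
Proof.
move=> st stn; have ts : t != s by rewrite eq_sym.
have [z0 z2 _ zo] := cox_rootP st; set z := cox_root (m s t) in z0 z2 zo.
suff zn : z ^+ n.*2 = 1 by case: zo => [/(_ n zn)|/(_ n zn)]; [right|left].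
have cts : cox_coef t s = z + z^-1 by rewrite cox_coef_sym /cox_coef (negPf st).
have zz : 1 - z * z != 0 by rewrite subr_eq0 eq_sym -expr2.
pose f (u : I) : algC := (u == t)%:R.
have E : foldr cox_step f (alt t s n.*2) = f.
  rewrite altE odd_double.
  suff /cox_step_pres /(_ f) : pres_eq (cox_rel m)
      (altl (letter s) (letter t) n.*2) [::].
    move=> /= E; rewrite -[RHS]E.
    by rewrite -[altl s t _]/(altl (letter s).1 (letter t).1 _) -map_altl foldr_map.
  apply/pres_classP; rewrite -word_val_gen word_val_altl galt_double.
  exact: stn.
(* The two coefficients solve al + be = 1 and al / z + be z = 0, the values of [f] at [t] and
   [s]. *)
have := @cox_step_alt t s z f (- (z * z) / (1 - z * z)) (1 / (1 - z * z)) n.*2 ts z0 cts.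
rewrite E odd_double /f eqxx (negPf st) /= mulr0n mulr1n.
have y0 : z ^+ n.*2 != 0 by rewrite expf_neq0.
case; [by field|by field; rewrite z0 zz|].
set y := z ^+ n.*2 in y0 *.
move=> e1 e2.
have yy : y = y^-1.
  apply/eqP; rewrite -subr_eq0; apply/eqP.
  transitivity (- (- (z * z) / (1 - z * z) * y / z + 1 / (1 - z * z) / y * z) * (1 - z * z) / z).
    by field; rewrite z0 zz y0.
  by rewrite -e2; ring.
apply: (mulfI zz); rewrite mulr1.
transitivity ((- (z * z) / (1 - z * z) * y + 1 / (1 - z * z) / y) * (1 - z * z)).
  by rewrite -[_ / y](congr1 (fun x => 1 / (1 - z * z) * x) yy); field.
by rewrite -e1; ring.
Qed.
End LinearRep.

(** * Coxeter groups and parabolic subgroups of Artin groups *)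

Section Coxeter.
Variables (I : choiceType) (m : I -> I -> option nat).
Hypothesis m_sym : forall s t, m s t = m t s.
Hypothesis m_gt1 : forall s t k, s != t -> m s t = Some k -> (1 < k)%N.

Local Notation W := (cox m).
Local Notation r := (rgen m).

Definition cword (u : seq I) : W := foldr (fun s w => r s * w) 1 u.

Lemma cword_cat u v : cword (u ++ v) = cword u * cword v.
Proof. by elim: u => [|s u IH] /=; rewrite ?mul1g // IH mulgA. Qed.

Lemma cword_class (u : word I) : pres_class (cox_rel m) u = cword (map fst u).
Proof.
rewrite -word_val_gen; elim: u => [|[s b] u IH] //=; rewrite IH /letter_val /=.
by case: b; rewrite // -/(r s) rgenV.
Qed.

Lemma cword_surj w : exists u, w = cword u.
Proof. by have [u ->] := pres_class_surj w; rewrite cword_class; exists (map fst u). Qed.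

Lemma cword_rev u : cword (rev u) = (cword u)^-1.
Proof.
elim: u => [|s u IH]; first by rewrite invg1.
by rewrite rev_cons -cats1 cword_cat IH /= mulg1 invgM rgenV.
Qed.

Lemma cword_altl a b n : cword (altl a b n) = galt (r a) (r b) n.
Proof. by elim: n a b => //= n IH a b; rewrite IH. Qed.

(* For [u = s_1 ... s_k], the reflections [s_1 ... s_i ... s_1]. *)
Fixpoint refls (u : seq I) : seq W :=
  if u is s :: u' then r s :: map (conjg^~ (r s)) (refls u') else [::].

Lemma refls_cat u v :
  refls (u ++ v) = refls u ++ map (conjg^~ (cword u)^-1) (refls v).
Proof.
elim: u => [|s u IH] /=.
  by rewrite invg1 (eq_map (@conjg1 _)) map_id.
rewrite IH map_cat -map_comp; congr (_ :: _ ++ _).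
by apply: eq_map => t /=; rewrite -conjgM invgM rgenV.
Qed.

Lemma refls_altl a b n :
  refls (altl a b n) = mkseq (fun i => (r a * r b) ^+ i * r a) n.
Proof.
elim: n a b => //= n IH a b; rewrite IH /mkseq /= -[1%N]addn0 iotaDl -!map_comp.
rewrite expg0 mul1g; congr (_ :: _); apply: eq_map => i /=.
rewrite conjgE rgenV add1n expgS -!mulgA; congr (_ * _).
elim: i => [|i IHi]; first by rewrite !expg0 !mul1g.
by rewrite !expgS -!mulgA IHi.
Qed.

(** The list [refls u] changes with the word, but these parities depend only on [cword u]: modulo 2
    they form a cocycle on W, by [par_word_cat]. *)
Definition par_word u t := odd (count_mem t (refls u)).

Lemma par_word_cat u v t :
  par_word (u ++ v) t = par_word u t (+) par_word v (t ^ cword u).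
Proof.
rewrite /par_word refls_cat count_cat oddD; congr (_ (+) odd _).
rewrite count_map; apply: eq_count => x /=.
by rewrite -(inj_eq (can_inj (conjgK (cword u)))) conjgKV.
Qed.

(** As [(r a * r b) ^+ k = 1], the two lists of reflections are reverses of each other. *)
Lemma par_word_braid a b k t : a != b -> m a b = Some k ->
  par_word (altl a b k) t = par_word (altl b a k) t.
Proof.
move=> ab mab; rewrite /par_word !refls_altl -[X in _ = odd X]count_rev; congr (odd (count _ _)).
have e : (r a * r b) ^+ k = 1 by apply: rgen_expg.
have ba : (r b * r a) = (r a * r b)^-1 by rewrite invgM !rgenV.
apply: (@eq_from_nth _ 1); rewrite ?size_rev !size_mkseq // => i ik.
rewrite nth_rev size_mkseq // !nth_mkseq //; last by rewrite ltn_subrL (leq_trans _ ik).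
rewrite ba; set c := r a * r b in e *.
apply: (mulgI (c ^+ (k - i.+1))).
rewrite expVgn mulVKg mulgA -expgnDr.
have -> : (k - i.+1 + i)%N = k.-1.
  by rewrite -{2}(subnK ik) addnS.
apply: (mulgI c); rewrite mulgA -expgS prednK ?(leq_ltn_trans _ ik) // e mul1g.
by rewrite /c -mulgA rgen_sq mulg1.
Qed.

Lemma par_word_eq u v : cword u = cword v -> par_word u =1 par_word v.
Proof.
have E (a b : word I) : pres_eq (cox_rel m) a b ->
    forall t, par_word (map fst a) t = par_word (map fst b) t.
  elim=> {a b} //= [a b [s t k st mst|s] x|x c t|a a' b b' aa' IHa _ IHb t|a b c _ IH _ IH' t].
  - rewrite !map_alt /= !altE; case: odd; last exact/esym/par_word_braid.
    exact: par_word_braid.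
  - by rewrite /par_word /= conjgE mulKg; case: eqP.
  - by rewrite /par_word /= conjgE mulKg; case: eqP.
  - rewrite !map_cat !par_word_cat IHa IHb -!cword_class.
    by have /pres_classP -> := aa'.
  - by rewrite IH IH'.
have lK w : map fst (map (@letter I) w) = w by rewrite -map_comp map_id.
move=> uv t; have := E (map (@letter I) u) (map (@letter I) v).
by rewrite !lK; apply; apply/pres_classP; rewrite !cword_class !lK.
Qed.

(* [par w t] holds iff [t] is a left inversion of [w], by the exchange condition. *)
Definition par (w : W) (t : W) := par_word (projT1 (cid (cword_surj w))) t.

Lemma par_cword u t : par (cword u) t = par_word u t.
Proof. by rewrite /par; case: cid => v /= /par_word_eq ->. Qed.

Lemma parM u v t : par (u * v) t = par u t (+) par v (t ^ u).
Proof.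
have [a ->] := cword_surj u; have [b ->] := cword_surj v.
by rewrite -cword_cat !par_cword par_word_cat.
Qed.

Lemma par1 t : par 1 t = false.
Proof. by rewrite -[1]/(cword [::]) par_cword. Qed.

Lemma par_gen s t : par (r s) t = (t == r s).
Proof.
have <- : cword [:: s] = r s by rewrite /= mulg1.
by rewrite par_cword /par_word /= mulg1 eq_sym addn0 oddb.
Qed.

(** Multiplying by the i-th reflection of the list deletes the i-th letter of the word. *)
Lemma refls_exchange u t : t \in refls u ->
  exists2 u', subseq u' u & size u = (size u').+1 /\ t * cword u = cword u'.
Proof.
elim: u t => //= s u IH t; rewrite inE => /predU1P[->|/mapP[x /IH[u' su' [zu' e]] ->]].
  by exists u; [exact: subseq_cons|split=> //; rewrite mulgA rgen_sq mul1g].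
exists (s :: u'); first by rewrite /= eqxx.
split=> /=; first by rewrite zu'.
by rewrite conjgE -!mulgA [r s * (r s * _)]mulgA rgen_sq mul1g rgenV -e.
Qed.

Lemma par_exchange u t : par (cword u) t ->
  exists2 u', subseq u' u & size u = (size u').+1 /\ t * cword u = cword u'.
Proof.
rewrite par_cword /par_word => h; apply: refls_exchange.
by rewrite -has_pred1 has_count; case: count h.
Qed.

Lemma cox_len_subproof w : exists n, `[< exists2 u, w = cword u & size u = n >].
Proof. by have [u ->] := cword_surj w; exists (size u); apply/asboolP; exists u. Qed.

Definition cox_len w := ex_minn (cox_len_subproof w).

Lemma cox_len_lt w t : par w t -> (cox_len (t * w) < cox_len w)%N.
Proof.
rewrite {2}/cox_len; case: ex_minnP => n /asboolP[u -> <-] _ /par_exchange.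
case=> u' _ [-> ->]; rewrite /cox_len ltnS; case: ex_minnP => k _; apply.
by apply/asboolP; exists u'.
Qed.

(** By the exact order of [r a * r b], the first [n] reflections of the alternating word are
    pairwise distinct, so each is counted once. *)
Lemma par_galt a b n i : a != b -> (forall k, m a b = Some k -> n <= k)%N ->
  (i < n)%N -> par (galt (r a) (r b) n) ((r a * r b) ^+ i * r a).
Proof.
move=> ab nk i_lt_n.
have wlog_ord x y : (x < y)%N -> (y < n)%N ->
    (r a * r b) ^+ x * r a <> (r a * r b) ^+ y * r a.
  move=> xy yn /mulIg; rewrite -(subnK (ltnW xy)) expgnDr -{1}[_ ^+ x]mul1g.
  move=> /mulIg/esym /(rgen_order m_sym m_gt1 ab)[/eqP|[k /nk nk' /dvdn_leq]].
    by rewrite subn_eq0 leqNgt xy.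
  rewrite subn_gt0 xy => /(_ isT); rewrite leqNgt => /negP; apply.
  by rewrite (leq_ltn_trans (leq_subr _ _)) // (leq_trans yn).
rewrite -cword_altl par_cword /par_word refls_altl count_uniq_mem.
  by rewrite oddb; apply/mapP; exists i; rewrite ?mem_iota.
rewrite map_inj_in_uniq ?iota_uniq // => x y; rewrite !mem_iota /= => xn yn e.
by case: (ltngtP x y) => // h; [case: (wlog_ord _ _ h yn)|case: (wlog_ord _ _ h xn)].
Qed.

Lemma rgen_inj : injective r.
Proof.
move=> s t st; apply/eqP; apply: contraT => nst.
have /(rgen_order m_sym m_gt1 nst) : (r s * r t) ^+ 1 = 1 by rewrite expg1 st rgen_sq.
by case=> // -[k /(m_gt1 nst) k1]; rewrite dvdn1 => /eqP k_1; rewrite k_1 in k1.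
Qed.

(** Makes labels invariant under conjugation: two pairs of simple reflections that are conjugate in
    W carry the same label. *)
Lemma rgen_order_label s t s' t' : s != t -> s' != t' ->
  (forall n, (r s * r t) ^+ n = 1 <-> (r s' * r t') ^+ n = 1) -> m s t = m s' t'.
Proof.
have half a b a' b' k : a != b -> a' != b' ->
    (forall n, (r a * r b) ^+ n = 1 <-> (r a' * r b') ^+ n = 1) ->
    m a b = Some k -> exists2 k', m a' b' = Some k' & (k' %| k)%N.
  move=> ab ab' E mab; have k0 : (0 < k)%N by rewrite ltnW // (m_gt1 ab mab).
  have /(rgen_order m_sym m_gt1 ab')[k_0|//] := (E k).1 (rgen_expg ab mab).
  by rewrite k_0 in k0.
move=> st st' E; have E' n : (r s' * r t') ^+ n = 1 <-> (r s * r t) ^+ n = 1.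
  exact: iff_sym.
case mst: (m s t) => [k|].
  have [k' mst' k'k] := half _ _ _ _ _ st st' E mst.
  have [k'' ] := half _ _ _ _ _ st' st E' mst'.
  rewrite mst mst' => -[<-] kk'; congr Some; apply/eqP.
  by rewrite eqn_dvd kk'.
case mst': (m s' t') => [k'|//].
by have [k''] := half _ _ _ _ _ st' st E' mst'; rewrite mst.
Qed.

(** If the first letter [s] is not [x], then [r s] is no inversion of [r x], hence it is one of the
    tail. The exchange condition then gives a word for [r x] that is two letters shorter and uses
    only letters of the tail. *)
Lemma cword_eq_gen u x : cword u = r x -> x \in u.
Proof.
have [n] := ubnP (size u); elim: n u => // n IH [_ /= e|s u].
  by have := par_gen x (r x); rewrite -e par1 eqxx.
rewrite ltnS => un e.
have [<-|nsx] := eqVneq s x; first exact: mem_head.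
have : ~~ par (cword (s :: u)) (r s).
  by rewrite e par_gen (inj_eq rgen_inj).
have {1}-> : cword (s :: u) = r s * cword u by [].
rewrite parM par_gen eqxx /= negbK conjgE mulKg => /par_exchange.
case=> u' su' [zu' eu']; rewrite inE (mem_subseq su') ?orbT //; apply: IH.
  by rewrite -ltnS -zu' (leq_trans un).
by rewrite -e -eu'.
Qed.

(** * Finite dihedral parabolic subgroups and their cosets *)

Section Dihedral.
Variables (s t : I) (k : nat).
Hypotheses (st : s != t) (mst : m s t = Some k).

Let k_gt0 : (0 < k)%N. Proof. by rewrite ltnW // (m_gt1 st mst). Qed.

Definition dihedral (w : W) : Prop := exists a b n,
  [/\ a = s /\ b = t \/ a = t /\ b = s, (n <= k)%N & w = galt (r a) (r b) n].

Lemma dihedral_swap a b : a = s /\ b = t \/ a = t /\ b = s ->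
  [/\ b = s /\ a = t \/ b = t /\ a = s, a != b & m a b = Some k].
Proof. by case=> -[-> ->]; split; auto; rewrite 1?eq_sym // m_sym. Qed.

Lemma dihedral_gen c w : c = s \/ c = t -> dihedral w -> dihedral (r c * w).
Proof.
move=> cst [a [b [n [ab nk ->]]]].
have [ba nab mab] := dihedral_swap ab.
have [ca|cb] : c = a \/ c = b by case: ab cst => -[-> ->] []; auto.
  rewrite {}ca; case: n nk => [|n] nk /=; first by exists a, b, 1%N.
  by rewrite mulgA rgen_sq mul1g; exists b, a, n; rewrite ltnW.
rewrite {}cb; move: nk; rewrite leq_eqVlt => /predU1P[->|nk]; last first.
  by exists b, a, n.+1.
rewrite (rgen_braid nab mab) -(prednK k_gt0) /= mulgA rgen_sq mul1g.
by exists a, b, k.-1; rewrite leq_pred.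
Qed.

Lemma dihedral1 : dihedral 1.
Proof. by exists s, t, 0%N; split; auto. Qed.

Lemma dihedralM v w : dihedral v -> dihedral w -> dihedral (v * w).
Proof.
move=> [a [b [n [ab _ ->]]]] dw; elim: n a b ab => [|n IH] a b ab /=.
  by rewrite mul1g.
have [ba _ _] := dihedral_swap ab; rewrite -mulgA; apply: dihedral_gen; last exact: IH.
by case: ab => -[->]; auto.
Qed.

Lemma dihedral_rgen c : c = s \/ c = t -> dihedral (r c).
Proof. by move=> cst; rewrite -[r c]mulg1; apply/(dihedral_gen cst)/dihedral1. Qed.

Lemma dihedralV w : dihedral w -> dihedral w^-1.
Proof.
move=> [a [b [n [ab _ ->]]]]; elim: n a b ab => [|n IH] a b ab /=.
  by rewrite invg1; exact: dihedral1.
have [ba _ _] := dihedral_swap ab; rewrite invgM rgenV; apply: dihedralM.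
  exact: IH.
by apply: dihedral_rgen; case: ab => -[->]; auto.
Qed.

Lemma dihedral_descent w : dihedral w -> w != 1 ->
  exists2 c, c = s \/ c = t & par w (r c).
Proof.
move=> [a [b [n [ab nk ->]]]] w1; have [_ nab mab] := dihedral_swap ab.
exists a; first by case: ab => -[->]; auto.
case: n nk w1 => [|n] nk; first by rewrite eqxx.
move=> _; have := @par_galt a b n.+1 0 nab.
by rewrite expg0 mul1g mab; apply=> // k' [<-].
Qed.

(** No dihedral reflection can be an inversion of a shortest element [e * w] of the coset. If [e]
    were not 1, a simple inversion of its inverse would be an inversion of [w], so [w] itself is
    shortest. *)
Lemma dihedral_min w d c :
  ~~ par w (r s) -> ~~ par w (r t) -> dihedral d -> c = s \/ c = t ->
  ~~ par w (r c ^ d).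
Proof.
move=> ws wt dd cst; apply: contraT; rewrite negbK => wcd.
pose P n := `[< exists2 e, dihedral e & cox_len (e * w) = n >].
have exP : exists n, P n.
  by exists (cox_len w); apply/asboolP; exists 1; [exact: dihedral1|rewrite mul1g].
have [n /asboolP[e de <-] minn] := ex_minnP exP.
have e_min f x : dihedral f -> x = s \/ x = t -> ~~ par (e * w) (r x ^ f).
  move=> df xst; apply/negP => /cox_len_lt; apply/negP; rewrite -leqNgt.
  apply: minn; apply/asboolP; exists (r x ^ f * e); last by rewrite mulgA.
  apply/dihedralM/de; rewrite conjgE.
  by apply/dihedralM/dihedralM => //; [exact: dihedralV|exact: dihedral_rgen].
have e1 : e = 1.
  apply/eqP; rewrite -invg_eq1; apply/eqP/eqP; apply: contraT.
  case/(dihedral_descent (dihedralV de)) => x xst ex.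
  have : ~~ par w (r x) by case: xst => ->.
  rewrite -[w](mulKg e) parM ex /= negbK.
  by rewrite (negPf (e_min _ _ (dihedralV de) xst)).
by have := e_min d c dd cst; rewrite e1 mul1g wcd.
Qed.

(* A reflection of the dihedral group that the minimal element [w] of its coset
   carries to a simple reflection is itself simple. *)
Lemma dihedral_simple w d x :
  ~~ par w (r s) -> ~~ par w (r t) -> dihedral d -> d * w = w * r x ->
  exists2 c, c = s \/ c = t & d = r c.
Proof.
move=> ws wt dd dwx.
have d1 : d != 1.
  apply/eqP => d1; move: dwx; rewrite d1 mul1g -{1}[w]mulg1 => /mulgI e.
  by have := par_gen x (r x); rewrite -e par1 eqxx.
have [c cst dc] := dihedral_descent dd d1; exists c => //.
have := congr1 (par^~ (r c)) dwx; rewrite !parM dc par_gen.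
rewrite (negPf (dihedral_min ws wt dd cst)).
have -> : par w (r c) = false by case: cst => ->; exact/negbTE.
move=> /= /esym/eqP e; apply: (mulIg w).
by rewrite dwx -e conjgE mulVKg.
Qed.

End Dihedral.

(** * The retraction of an Artin group onto a parabolic subgroup *)

Section Retraction.
Variable X : I -> Prop.

(* Minimal representatives of the left cosets of the parabolic subgroup of X. *)
Definition mincos (w : W) := forall x, X x -> ~~ par w^-1 (r x).

Definition out w g : option I :=
  if pselect (exists x, X x /\ r g * w = w * r x) is left h
  then Some (projT1 (cid h)) else None.

Lemma outP w g x : out w g = Some x -> X x /\ r g * w = w * r x.
Proof. by rewrite /out; case: pselect => // h [<-]; case: cid. Qed.

Lemma out_Some w g x : X x -> r g * w = w * r x -> out w g = Some x.
Proof.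
move=> Xx e; rewrite /out; case: pselect => [h|[]]; last by exists x.
case: cid => y /= [_]; rewrite e => /mulgI /rgen_inj e'; by rewrite e'.
Qed.

Lemma mincos1 : mincos 1.
Proof. by move=> x _; rewrite invg1 par1. Qed.

(** Deodhar's lemma: a simple reflection either fixes the coset of a minimal representative or
    carries it to another minimal representative. *)
Lemma mincos_step w g : mincos w -> out w g = None -> mincos (r g * w).
Proof.
move=> wX wg x Xx; rewrite invgM parM rgenV par_gen (negPf (wX _ Xx)) /=.
apply/eqP => e; have := out_Some Xx (g := g) (w := w); rewrite wg => H.
by have := H; rewrite -e conjgE invgK mulgA mulgVK => /(_ erefl).
Qed.

Lemma out_par w g x : mincos w -> out w g = Some x -> ~~ par w (r g).
Proof.
move=> wX /outP[Xx e]; have := par1 (r g); rewrite -(mulgV w) parM.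
by rewrite conjgE e mulKg (negPf (wX _ Xx)) addbF => ->.
Qed.

Lemma out_rgen w g : out w g = None -> out (r g * w) g = None.
Proof.
case E: (out (r g * w) g) => [x|//]; have [Xx e] := outP E.
rewrite (@out_Some _ _ x) //; apply: (mulgI (r g)).
by rewrite e mulgA.
Qed.

(* One step of the retraction: the state [w] is a minimal coset representative, and
   a letter that fixes the coset, [g w = w x] with [x] in X, is output as [x]. *)
Definition sstep (l : I * bool) (o : W * artin m) : W * artin m :=
  if out o.1 l.1 is Some x then (o.1, letter_val (sgen m) (x, l.2) * o.2)
  else (r l.1 * o.1, o.2).

Lemma sstep_mincos l o : mincos o.1 -> mincos (sstep l o).1.
Proof. by rewrite /sstep; case E: out => [x|] //= ?; exact: mincos_step. Qed.

Lemma sstepK x b o : sstep (x, b) (sstep (x, ~~ b) o) = o.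
Proof.
case: o => w a; rewrite /sstep /=; case E: (out w x) => [y|] /=.
  by rewrite E mulgA /letter_val /=; case: b; rewrite /= ?mulVg ?mulgV mul1g.
by rewrite out_rgen // mulgA rgen_sq mul1g.
Qed.

(** Outputs on a dihedral orbit are inherited from its minimal element [w]: the conjugate of [r g]
    by [d] is carried by [w] to a simple reflection, so [dihedral_simple] makes it [r s] or
    [r t]. *)
Lemma out_dihedral s t k w d g x : s != t -> m s t = Some k ->
  ~~ par w (r s) -> ~~ par w (r t) -> dihedral s t k d -> g = s \/ g = t ->
  out (d * w) g = Some x ->
  exists2 c, c = s \/ c = t & r g * d = d * r c /\ out w c = Some x.
Proof.
move=> st mst ws wt dd gst /outP[Xx e].
have e' : r g ^ d * w = w * r x.
  by rewrite conjgE -!mulgA e -mulgA mulKg.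
have ddg : dihedral s t k (r g ^ d).
  rewrite conjgE; apply: (dihedralM st mst).
    exact: dihedralV.
  by apply: (dihedralM st mst) => //; exact: (dihedral_rgen st mst).
have [c cst dc] := dihedral_simple st mst ws wt ddg e'.
exists c => //; split; first by rewrite -dc conjgE mulVKg.
by apply: out_Some => //; rewrite -dc.
Qed.

Lemma out_conj w d g c x : r g * d = d * r c -> out w c = Some x ->
  out (d * w) g = Some x.
Proof.
move=> e /outP[Xx e']; apply: out_Some => //.
by rewrite mulgA e -!mulgA e'.
Qed.

Inductive reach (s t : I) (w : W) : W -> Prop :=
  | Reach_refl : reach s t w w
  | Reach_step g w' : g = s \/ g = t -> reach s t w w' -> out w' g = None ->
      reach s t w (r g * w').

Lemma reach_min s t w : mincos w -> exists w0,
  [/\ mincos w0, ~~ par w0 (r s), ~~ par w0 (r t) & reach s t w0 w].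
Proof.
have [n] := ubnP (cox_len w); elim: n w => // n IH w wn wX.
have step g : g = s \/ g = t -> par w (r g) -> exists w0,
  [/\ mincos w0, ~~ par w0 (r s), ~~ par w0 (r t) & reach s t w0 w].
  move=> gst wg; have og : out w g = None.
    by case E: (out w g) => [x|//]; have := out_par wX E; rewrite wg.
  have [||w0 [w0X w0s w0t w0w]] := IH (r g * w).
  - by rewrite -ltnS (leq_trans _ wn) // ltnS cox_len_lt.
  - exact: mincos_step.
  exists w0; split=> //; rewrite -[w](mulKg (r g)) rgenV; apply: Reach_step => //.
  exact: out_rgen.
have [ws|ws] := boolP (par w (r s)); first exact: (step s (or_introl erefl)).
have [wt|wt] := boolP (par w (r t)); first exact: (step t (or_intror erefl)).
by exists w; split=> //; exact: Reach_refl.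
Qed.

Lemma reach_dihedral s t k w w' : s != t -> m s t = Some k -> reach s t w w' ->
  exists2 d, dihedral s t k d & w' = d * w.
Proof.
move=> st mst; elim=> [|g {}w' gst _ [d dd ->] _].
  by exists 1; [exact: dihedral1|rewrite mul1g].
by exists (r g * d); [exact: dihedral_gen|rewrite mulgA].
Qed.

Local Notation run := (foldr (fun l => sstep l)).

Lemma run_free s t k w d a n : s != t -> m s t = Some k ->
  ~~ par w (r s) -> ~~ par w (r t) -> out w s = None -> out w t = None ->
  dihedral s t k d ->
  run (d * w, a) (alt (letter s) (letter t) n) = (cword (alt s t n) * (d * w), a) /\
  run (d * w, a) (alt (letter t) (letter s) n) = (cword (alt t s n) * (d * w), a).
Proof.
move=> st mst ws wt os ot.
have od e g : dihedral s t k e -> g = s \/ g = t -> out (e * w) g = None.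
  move=> de gst; case E: out => [x|//].
  have [c cst [_]] := out_dihedral st mst ws wt de gst E.
  by case: cst => ->; rewrite ?os ?ot.
elim: n d => [|n IH] d dd; first by rewrite /= mul1g.
have step g b : g = s \/ g = t ->
  run (d * w, a) (rcons b (letter g)) = run (r g * d * w, a) b.
  by move=> gst; rewrite -cats1 foldr_cat /= {2}/sstep /= od // mulgA.
have [s_st t_st] : (s = s \/ s = t) /\ (t = s \/ t = t) by split; auto.
rewrite /= !step // -!cats1 !cword_cat /= !mulg1.
have [_ ->] := IH _ (dihedral_gen st mst s_st dd).
have [-> _] := IH _ (dihedral_gen st mst t_st dd).
by rewrite !mulgA.
Qed.

Lemma run_fixed s t x y w a n : out w s = Some x -> out w t = Some y ->
  run (w, a) (alt (letter s) (letter t) n) =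
    (w, word_val (sgen m) (alt (letter x) (letter y) n) * a) /\
  run (w, a) (alt (letter t) (letter s) n) =
    (w, word_val (sgen m) (alt (letter y) (letter x) n) * a).
Proof.
move=> ox oy; elim: n a => [|n IH] a /=; first by rewrite mul1g.
rewrite -!cats1 !foldr_cat !word_val_cat /= {2 4}/sstep /= ox oy /=.
have [_ ->] := IH (letter_val (sgen m) (x, false) * a).
have [-> _] := IH (letter_val (sgen m) (y, false) * a).
by rewrite /letter_val /= !mulg1 !mulgA.
Qed.

Lemma run_fixed_braid s t k x y w : s != t -> m s t = Some k ->
  out w s = Some x -> out w t = Some y ->
  word_val (sgen m) (alt (letter x) (letter y) k) =
  word_val (sgen m) (alt (letter y) (letter x) k).
Proof.
move=> st mst /outP[_ ex] /outP[_ ey].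
have rx : r x = r s ^ w by rewrite conjgE ex mulKg.
have ry : r y = r t ^ w by rewrite conjgE ey mulKg.
have xy : x != y.
  apply: contra st => /eqP exy; apply/eqP/rgen_inj/(can_inj (conjgK w)).
  by rewrite -rx -ry exy.
apply/word_val_alt_eq; apply: sgen_braid => //.
rewrite -mst; apply: rgen_order_label => // n.
rewrite rx ry -conjMg -conjXg.
by split=> [/eqP|->]; rewrite ?conj1g // conjg_eq1 => /eqP.
Qed.

Section Path.
Variables (s t : I) (k : nat) (w : W) (x : I).
Hypotheses (st : s != t) (mst : m s t = Some k).
Hypotheses (ws : ~~ par w (r s)) (wt : ~~ par w (r t)).
Hypotheses (os : out w s = None) (ot : out w t = Some x).

(* The states reachable from [w] form a path [node 0, ..., node k.-1], where
   [lab i] joins [node i.-1] to [node i]; the two end nodes are fixed by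
   [lab 0] and [lab k], with the same output [x]. *)
Let lab i := if odd i then s else t.
Let node i := cword (alt s t i) * w.

Let k_gt0 : (0 < k)%N. Proof. by rewrite ltnW // (m_gt1 st mst). Qed.

Let lab_st i : lab i = s \/ lab i = t.
Proof. by rewrite /lab; case: odd; auto. Qed.

Let labSS i : lab i.+2 = lab i.
Proof. by rewrite /lab /= negbK. Qed.

Let alt_lab i : cword (alt s t i.+1) = r (lab i.+1) * cword (alt s t i).
Proof.
rewrite !altE /lab /=; case: odd => //=.
Qed.

Let nodeS i : node i.+1 = r (lab i.+1) * node i.
Proof. by rewrite /node alt_lab mulgA. Qed.

Let dihedral_alt i : dihedral s t k (cword (alt s t i)).
Proof.
elim: i => [|i IH]; first exact: dihedral1.
by rewrite alt_lab; apply: dihedral_gen.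
Qed.

Let alt_neq i : (i.+1 < k)%N -> cword (alt s t i.+1) <> cword (alt t s i.+1).
Proof.
move=> ik; rewrite !altE => e.
have : galt (r s) (r t) i.+1 = galt (r t) (r s) i.+1.
  by rewrite -!cword_altl; case: odd e.
move/galt_eq; rewrite !rgen_sq => /(_ erefl erefl).
case/(rgen_order m_sym m_gt1 st) => // -[k']; rewrite mst => -[<-] /dvdn_leq.
by move=> /(_ isT); rewrite leqNgt ik.
Qed.

Let out_up i : (i.+1 < k)%N -> out (node i) (lab i.+1) = None.
Proof.
move=> ik; case E: out => [y|//].
have [c cst [e oc]] := out_dihedral st mst ws wt (dihedral_alt i) (lab_st i.+1) E.
case: cst oc e => ->; first by rewrite os.
move=> _ e; case: (alt_neq ik); rewrite alt_lab e.
by rewrite [alt t s _]/= -cats1 cword_cat /= mulg1.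
Qed.

Let step_up i a : (i.+1 < k)%N -> sstep (letter (lab i.+1)) (node i, a) = (node i.+1, a).
Proof. by move=> ik; rewrite /sstep /= out_up // nodeS. Qed.

Let step_down i a : (i.+1 < k)%N -> sstep (letter (lab i.+1)) (node i.+1, a) = (node i, a).
Proof.
move=> ik; rewrite /sstep /= nodeS out_rgen ?out_up //.
by rewrite mulgA rgen_sq mul1g.
Qed.

Let step_first a : sstep (letter t) (node 0, a) = (node 0, sgen m x * a).
Proof. by rewrite /sstep /node /= mul1g ot. Qed.

Let out_last : out (node k.-1) (lab k) = Some x.
Proof.
apply: out_conj ot; rewrite -{1}(prednK k_gt0) -alt_lab prednK //.
have -> : cword (alt s t k) = cword (alt t s k).
  have e := rgen_braid st mst.
  by rewrite !altE; case: odd; rewrite !cword_altl e.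
by rewrite -{1}(prednK k_gt0) /= -cats1 cword_cat /= mulg1.
Qed.

Let step_last a : sstep (letter (lab k)) (node k.-1, a) = (node k.-1, sgen m x * a).
Proof. by rewrite /sstep /= out_last. Qed.

Let walk i n := alt (letter (lab i)) (letter (lab i.+1)) n.

Let walkS o i n : run o (walk i n.+1) = run (sstep (letter (lab i)) o) (walk i.+1 n).
Proof. by rewrite /walk alt_foldr labSS. Qed.

Let walk_up i n a p : (i + n < k)%N ->
  run (node i, a) (walk i.+1 (n + p)) = run (node (i + n), a) (walk (i + n).+1 p).
Proof.
elim: n i => [|n IH] i; first by rewrite addn0.
rewrite addnS -addSn => ink; rewrite addSn walkS step_up; last first.
  by rewrite (leq_ltn_trans _ ink) ?leq_addr.
exact: IH.
Qed.

Let walk_down i n a p : (i + n < k)%N ->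
  run (node (i + n), a) (walk (i + n) (n + p)) = run (node i, a) (walk i p).
Proof.
elim: n i p => [|n IH] i p; first by rewrite addn0.
rewrite addnS => ink; rewrite addSn walkS step_down //.
have -> q : walk (i + n).+2 q = walk (i + n) q by rewrite /walk !labSS.
by apply: IH; exact: ltnW.
Qed.

(** Both words output [x] exactly once and end at node k - 1 - i. One walks down to node 0, is held
    there for one letter and walks up; the other does the same at the end k - 1 and walks down. *)
Lemma run_path i a : (i < k)%N ->
  run (node i, a) (alt (letter s) (letter t) k) =
  run (node i, a) (alt (letter t) (letter s) k).
Proof.
move=> ik.
suff E : run (node i, a) (walk i k) = run (node i, a) (walk i.+1 k).
  by move: E; rewrite /walk /lab /=; case: odd => /=.
have ki : k = (i + (k - i.+1).+1)%N by rewrite -addSnnS subnKC.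
have ki' : k = (k - i.+1 + i.+1)%N by rewrite subnK.
rewrite {1}ki -{1 2}[i]add0n walk_down //.
rewrite walkS step_first -[X in walk 1 X]addn0 walk_up ?add0n /=; last first.
  by rewrite ltn_subrL.
rewrite {2}ki' walk_up; last by rewrite {2}ki addnS.
have -> : (i + (k - i.+1) = k.-1)%N by rewrite {2}ki addnS.
rewrite prednK // walkS step_last.
have -> : walk k.+1 i = walk k.-1 i by rewrite -{1}(prednK k_gt0) /walk !labSS.
have e : k.-1 = (k - i.+1 + i)%N by rewrite {1}ki' addnS.
by rewrite e -[X in walk _ X]addn0 walk_down // -e prednK.
Qed.

End Path.

Lemma reach_path s t k w w' x : s != t -> m s t = Some k ->
  ~~ par w (r s) -> ~~ par w (r t) -> out w s = None -> out w t = Some x ->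
  reach s t w w' -> exists2 i, (i < k)%N & w' = cword (alt s t i) * w.
Proof.
move=> st mst ws wt os ot; have k0 : (0 < k)%N by rewrite ltnW // (m_gt1 st mst).
elim=> [|g {}w' gst _ [i ik ->]]; first by exists 0%N; rewrite //= mul1g.
have altS j : cword (alt s t j.+1) = r (if odd j then t else s) * cword (alt s t j).
  by rewrite !altE /=; case: odd.
have [->|->] : g = (if odd i then t else s) \/ g = (if odd i then s else t).
  by case: gst => ->; case: odd; auto.
  move=> o; exists i.+1; last by rewrite altS mulgA.
  rewrite ltn_neqAle ik andbT; apply: contraTneq isT => ik'.
  suff : out (cword (alt s t i) * w) (if odd i then t else s) = Some x by rewrite o.
  apply: out_conj ot; rewrite -altS ik'.
  have -> : cword (alt s t k) = cword (alt t s k).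
    have e := rgen_braid st mst.
    by rewrite !altE; case: odd; rewrite !cword_altl e.
  by rewrite -ik' /= -cats1 cword_cat /= mulg1.
case: i ik => [|i] ik; first by rewrite /= mul1g ot.
move=> _; exists i; first exact: ltnW.
by rewrite altS /= if_neg !mulgA rgen_sq mul1g.
Qed.

(** The cases are which of [s] and [t] fix the coset of the minimal element [w0] of the orbit. If
    both do, the orbit is a point and the outputs satisfy a braid relation with the same label; if
    one does, the orbit is a path; if none does, nothing is output. *)
Lemma run_braid s t k w a : s != t -> m s t = Some k -> mincos w ->
  run (w, a) (alt (letter s) (letter t) k) =
  run (w, a) (alt (letter t) (letter s) k).
Proof.
move=> st mst wX; have [w0 [w0X ws wt wr]] := reach_min s t wX.
have ts : t != s by rewrite eq_sym.
have mts : m t s = Some k by rewrite m_sym.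
case os: (out w0 s) => [x|]; case ot: (out w0 t) => [y|].
- have <- : w0 = w.
    by elim: wr => // g w' gst _ <-; case: gst => ->; rewrite ?os ?ot.
  have [-> ->] := run_fixed a k os ot.
  by rewrite (run_fixed_braid st mst os ot).
- have wr' : reach t s w0 w.
    elim: wr => [|g w' gst _ IH o]; first exact: Reach_refl.
    by apply: Reach_step => //; case: gst; auto.
  have [i ik ->] := reach_path ts mts wt ws ot os wr'.
  by rewrite (run_path ts mts wt ws ot os).
- have [i ik ->] := reach_path st mst ws wt os ot wr.
  by rewrite (run_path st mst ws wt os ot).
- have [d dd ->] := reach_dihedral st mst wr.
  have [-> ->] := run_free a k st mst ws wt os ot dd.
  congr (_ * _, _); have e := rgen_braid st mst.
  by rewrite !altE; case: odd; rewrite !cword_altl e.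
Qed.

Lemma run_pres u v : pres_eq (artin_rel m) u v -> run (1, 1) u = run (1, 1) v.
Proof.
move=> uv; apply: (pres_act (V := fun o => mincos o.1) _ _ _ uv) => //=.
- exact: sstep_mincos.
- by move=> x b o _; exact: sstepK.
- by move=> _ _ [s t k st mst] [w a] /= wX; exact: run_braid.
- exact: mincos1.
Qed.

End Retraction.

Lemma par_eq0 w : (forall s, ~~ par w (r s)) -> w = 1.
Proof.
have [u ->] := cword_surj w; have [n] := ubnP (size u).
elim: n u => // n IH [//|s u]; rewrite ltnS => un w0.
have := w0 s; rewrite parM par_gen eqxx /= negbK conjgE mulKg => /par_exchange.
case=> u' _ [zu' e]; move: w0; rewrite /= e; apply: IH.
by rewrite -ltnS -zu' (leq_trans un).
Qed.

Lemma cword_altS s t i :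
  cword (alt s t i.+1) = r (if odd i then t else s) * cword (alt s t i).
Proof. by rewrite !altE /=; case: odd. Qed.

Lemma cword_alt_rcons s t i : cword (alt s t i.+1) = cword (alt t s i) * r s.
Proof. by rewrite /= -cats1 cword_cat /= mulg1. Qed.

Lemma cword_alt_braid s t k : s != t -> m s t = Some k ->
  cword (alt s t k) = cword (alt t s k).
Proof.
by move=> st mst; have e := rgen_braid st mst; rewrite !altE; case: odd; rewrite !cword_altl e.
Qed.

(** * The mixed relations and obtuse pairs of roots *)

Section Va3.
Variables (s t : I) (k : nat).
Hypotheses (st : s != t) (mst : m s t = Some k).
Let P := cword (alt s t k.-1).
Let q := if odd k then s else t.

Let k_gt0 : (0 < k)%N. Proof. by rewrite ltnW // (m_gt1 st mst). Qed.

Lemma va3_refl : P * r t = r q * P.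
Proof.
rewrite -cword_alt_rcons prednK // -cword_alt_braid // -{1}(prednK k_gt0).
by rewrite cword_altS; congr (r _ * _); rewrite /q -{2}(prednK k_gt0) /= if_neg.
Qed.

(** Decides the sign: [P] carries alpha_t to alpha_q and not to its opposite. The product
    [P^-1 * r q] is the longest dihedral element, and its inversion [r t] comes from the last
    letter. *)
Lemma va3_par : ~~ par P^-1 (r t).
Proof.
have e : cword (rev (alt s t k)) = P^-1 * r q.
  rewrite cword_rev -{1}(prednK k_gt0) cword_altS invgM rgenV.
  by congr (_ * r _); rewrite /q -{2}(prednK k_gt0) /= if_neg.
have ts : t != s by rewrite eq_sym.
have mts : m t s = Some k by rewrite m_sym.
have e' : P^-1 * r q = galt (r t) (r s) k.
  rewrite -e cword_rev cword_alt_braid // -cword_rev.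
  have -> : rev (alt t s k) = altl t s k.
    elim: k (t) (s) => //= n IH a b.
    by rewrite rev_rcons IH.
  by rewrite cword_altl.
have : par (P^-1 * r q) (r t).
  rewrite e'; have := @par_galt t s k 0 ts.
  by rewrite expg0 mul1g mts; apply=> // k' [<-].
have -> : par (P^-1 * r q) (r t) = par P^-1 (r t) (+) (r t ^ P^-1 == r q).
  by rewrite parM par_gen.
have -> : r t ^ P^-1 = r q by rewrite conjgE invgK mulgA va3_refl mulgK.
by rewrite eqxx addbT.
Qed.

End Va3.

(* The pair of roots [u alpha_{s'}, u alpha_{t'}] is never the image
   [t alpha_s, alpha_t] of [alpha_s, - alpha_t] under [t]. *)
Lemma obtuse_pair s t k u s' t' : s != t -> m s t = Some k -> (2 < k)%N ->
  u * r t' = r t * u -> ~~ par u^-1 (r t') ->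
  u * r s' = r s ^ r t * u -> ~~ par u^-1 (r s') -> False.
Proof.
move=> st mst k2 ut' pt' us' ps'.
have [u0 [_ u0s u0t /(reach_dihedral st mst)[d dd ud]]] :=
  @reach_min (fun=> False) s t u (fun _ => False_ind _).
have simple x c : dihedral s t k x -> u * r c = x * u -> ~~ par u^-1 (r c) ->
    exists2 y, y = s \/ y = t & x ^ d = r y /\ ~~ par d^-1 (r y).
  move=> dx e pc.
  have e' : x ^ d * u0 = u0 * r c.
    by rewrite conjgE -!mulgA -ud -e ud !mulgA mulVg mul1g.
  have dxd : dihedral s t k (x ^ d).
    rewrite conjgE; apply: dihedralM => //; first exact: dihedralV.
    exact: dihedralM.
  have [y yst xy] := dihedral_simple st mst u0s u0t dxd e'.
  exists y => //; split=> //; move: pc; rewrite ud invgM parM.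
  have -> : r c ^ u0^-1 = r y by rewrite conjgE invgK mulgA -e' xy mulgK.
  suff /negbTE -> : ~~ par u0^-1 (r c) by [].
  have := par1 (r y) : par (1 : cox m) (r y) = false.
  rewrite -(mulgV u0) parM.
  have -> : r y ^ u0 = r c by rewrite conjgE -xy e' mulKg.
  have /negbTE -> : ~~ par u0 (r y) by case: yst => ->.
  by move=> /= ->.
have [ds dt] : dihedral s t k (r s) /\ dihedral s t k (r t).
  by split; apply: dihedral_rgen => //; auto.
have [c1 c1st [d1 p1]] := simple _ _ dt ut' pt'.
have [|c2 c2st [d2 p2]] := simple (r s ^ r t) s' _ us' ps'.
  by rewrite conjgE; apply: dihedralM => //; [exact: dihedralV|exact: dihedralM].
have c12 : c1 <> c2.
  move=> c12; move: d2; rewrite -c12 -d1 => /conjg_inj.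
  have {2}<- : r t ^ r t = r t by rewrite conjgE mulKg.
  by move=> /conjg_inj/rgen_inj e; rewrite e eqxx in st.
have [ps pt] : ~~ par d^-1 (r s) /\ ~~ par d^-1 (r t).
  by case: c1st c12 p1 p2; case: c2st => -> -> //; split.
have dV : d^-1 = 1.
  apply/eqP; apply: contraT => /(dihedral_descent st mst (dihedralV st mst dd)).
  by case=> c [] ->; rewrite ?(negPf ps) ?(negPf pt).
have d_1 : d = 1 by rewrite -[d]invgK dV invg1.
move: d1 d2; rewrite d_1 !conjg1 => /rgen_inj tc1.
have -> : c2 = s by case: c1st c12 tc1 => ->; case: c2st => -> // _ e; rewrite e eqxx in st.
rewrite conjgE rgenV => e.
have /(rgen_order m_sym m_gt1 st) : (r s * r t) ^+ 2 = 1.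
  by rewrite expg2 -{1}e -!mulgA [r t * (r t * _)]mulgA rgen_sq mul1g [r s * (r s * _)]mulgA rgen_sq mul1g rgen_sq.
case=> // -[k']; rewrite mst => -[<-] /dvdn_leq.
by move=> /(_ isT); rewrite leqNgt k2.
Qed.

Definition gen_by (Y : I -> Prop) (g : artin m) : Prop :=
  exists2 u : word I, (forall l, l \in u -> Y l.1) & g = pres_class (artin_rel m) u.

(** An output [x] satisfies [r x = v^-1 * r g * v] with [g] and the letters of [v] in [Y], so
    [cword_eq_gen] puts [x] in [Y]. *)
Lemma run_gen_by X Y u : (forall l : I * bool, l \in u -> Y l.1) ->
  (exists2 v, (forall x, x \in v -> Y x) &
     (foldr (fun l => sstep X l) (1, 1) u).1 = cword v) /\
  gen_by (fun x => X x /\ Y x) (foldr (fun l => sstep X l) (1, 1) u).2.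
Proof.
elim: u => [_|[g b] u IH uY] /=.
  by split; [exists [::]|exists [::]].
have gY : Y g := uY _ (mem_head _ _).
have [|[v vY ev] [u' u'Y eu']] := IH.
  by move=> l lu; apply: uY; rewrite inE lu orbT.
rewrite /sstep; case E: out => [x|] /=; last first.
  split; last by exists u'.
  exists (g :: v); last by rewrite /= -ev.
  by move=> z; rewrite inE => /predU1P[->|/vY].
split; first by exists v.
have [Xx] := outP E; rewrite ev => e.
have Yx : Y x.
  have : cword (rev v ++ g :: v) = r x by rewrite cword_cat cword_rev /= e mulKg.
  move/cword_eq_gen; rewrite mem_cat mem_rev inE.
  by case/orP => [/vY|/predU1P[->|/vY]].
exists ((x, b) :: u').
  by move=> l; rewrite inE => /predU1P[->|/u'Y].
by rewrite eu' -!word_val_gen.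
Qed.

Lemma run_self X u : (forall l : I * bool, l \in u -> X l.1) ->
  foldr (fun l => sstep X l) (1, 1) u = (1, pres_class (artin_rel m) u).
Proof.
elim: u => [_|[g b] u IH uX] //=; rewrite IH; last first.
  by move=> l lu; apply: uX; rewrite inE lu orbT.
rewrite /sstep /= (@out_Some _ _ _ g) ?mulg1 ?mul1g -?word_val_gen //.
exact: (uX _ (mem_head _ _)).
Qed.

(* Van der Lek's theorem, by means of the retraction onto [gen_by X] that follows
   a word through the cosets of the parabolic subgroup of X in W and keeps a letter
   exactly when it fixes the current coset. *)
Theorem gen_by_inter X Y g : gen_by X g -> gen_by Y g ->
  gen_by (fun x => X x /\ Y x) g.
Proof.
move=> [u uX gu] [v vY gv].
have [_] := run_gen_by X vY; rewrite -(@run_pres X u v).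
  by rewrite run_self // -gu.
by apply/pres_classP; rewrite -gu -gv.
Qed.

End Coxeter.

(** * Amalgamated products in Artin groups *)

Section GenBy.
Variables (I : choiceType) (m : I -> I -> option nat).
Local Notation A := (artin m).

Lemma gen_by1 Y : gen_by (m := m) Y 1.
Proof. by exists [::]. Qed.

Lemma gen_byM Y g h : gen_by (m := m) Y g -> gen_by Y h -> gen_by Y (g * h).
Proof.
move=> [u uY ->] [v vY ->]; exists (u ++ v); last by rewrite pres_classM.
by move=> l; rewrite mem_cat => /orP[/uY|/vY].
Qed.

Lemma gen_by_letter (Y : I -> Prop) x b : Y x ->
  gen_by (m := m) Y (letter_val (sgen m) (x, b)).
Proof.
move=> Yx; exists [:: (x, b)]; first by move=> l; rewrite inE => /eqP ->.
by rewrite -word_val_gen /= mulg1.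
Qed.

Lemma gen_by_gen (Y : I -> Prop) x : Y x -> gen_by Y (sgen m x).
Proof. exact: (@gen_by_letter Y x false). Qed.

Lemma gen_byV Y g : gen_by (m := m) Y g -> gen_by Y g^-1.
Proof.
case=> u uY ->; elim: u uY => [|[x b] u IH] uY; first by rewrite invg1; exact: gen_by1.
rewrite -cat1s pres_classM invgM; apply: gen_byM.
  by apply: IH => l lu; apply: uY; rewrite inE lu orbT.
have := @gen_by_letter Y x (~~ b) (uY _ (mem_head _ _)).
by case: b {uY} => /= h //; rewrite pres_class_inv invgK.
Qed.

Lemma gen_by_sub (Y Z : I -> Prop) g : gen_by (m := m) Y g ->
  (forall x, Y x -> Z x) -> gen_by Z g.
Proof. by move=> [u uY ->] YZ; exists u => // l /uY /YZ. Qed.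

Lemma gen_by_empty (Y : I -> Prop) g : gen_by (m := m) Y g -> (forall x, ~ Y x) -> g = 1.
Proof. by move=> [[|l u] uY ->] Y0 //; case: (Y0 _ (uY l (mem_head _ _))). Qed.

Lemma sgen_sq_neq1 x : sgen m x * sgen m x != 1.
Proof.
(* Both sides of a braid relation have the same length, so all generators may be sent to 1 in Z/3,
   where 1 + 1 is not 0. *)
have braid u v : artin_rel m u v ->
    word_val (fun=> Zp1 : 'I_3) u = word_val (fun=> Zp1 : 'I_3) v.
  by case=> s t k _ _; apply/word_val_alt_eq.
apply/eqP => /(congr1 (pres_hom braid)).
rewrite pres_homM !pres_hom_gen morph_group1 //; last exact: pres_homM.
Qed.

Hypothesis m_sym : forall s t, m s t = m t s.
Hypothesis m_gt1 : forall s t k, s != t -> m s t = Some k -> (1 < k)%N.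

(** If every generator could be avoided, intersecting over the finitely many letters of one word for
    [g] would place [g] in the parabolic subgroup on no generators. *)
Lemma gen_by_neq1 (Y : I -> Prop) (g : A) : gen_by Y g -> g <> 1 ->
  exists2 y, Y y & ~ gen_by (fun z => z <> y) g.
Proof.
move=> [u uY gu] g1; apply: contrapT => noy.
have ly y : Y y -> gen_by (fun z => z <> y) g.
  by move=> Yy; apply: contrapT => ny; apply: noy; exists y.
have lu : forall l : seq I, {subset l <= map fst u} -> gen_by (fun z => z \notin l) g.
  elim=> [|y l IH] ylu; first by exists u.
  have /ly yn : Y y.
    by have /mapP[x xu ->] := ylu y (mem_head _ _); apply: uY.
  have ln : gen_by (fun z => z \notin l) g.
    by apply: IH => z zl; apply: ylu; rewrite inE zl orbT.
  apply: (gen_by_sub (gen_by_inter m_sym m_gt1 yn ln)) => z [zy zl].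
  by rewrite inE negb_or zl andbT; apply/eqP.
have gu' : gen_by (fun z => z \in map fst u) g.
  by exists u => // l lu'; exact: map_f.
apply/g1/(gen_by_empty (gen_by_inter m_sym m_gt1 (lu _ (fun=> id)) gu')).
by move=> x [/negP].
Qed.

Lemma sgen_nmem b : ~ gen_by (fun z => z <> b) (sgen m b) /\
  ~ gen_by (fun z => z <> b) (sgen m b * sgen m b).
Proof.
have bb : gen_by (fun z => z = b) (sgen m b) by apply: gen_by_gen.
suff E : ~ gen_by (fun z => z <> b) (sgen m b * sgen m b).
  by split=> // h; apply: E; apply: gen_byM.
move=> h; move/eqP: (sgen_sq_neq1 b); apply.
by apply: (gen_by_empty (gen_by_inter m_sym m_gt1 h (gen_byM bb bb))) => x [].
Qed.

(** * The amalgam attached to a pair of generators with infinite label *)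

Section Amalgam.
Variables b b' : I.
Hypotheses (bb' : b <> b') (mbb' : m b b' = None).

(* [A] is the amalgamated product of [side true] and [side false] over [edge]: no
   relation involves both [b] and [b'], so it suffices to let generators act on
   normal forms through one of the two sides. *)
Definition side (c : bool) : A -> Prop := gen_by (fun z => z <> if c then b' else b).
Definition edge (g : A) := side true g /\ side false g.

Lemma sideM c g h : side c g -> side c h -> side c (g * h).
Proof. exact: gen_byM. Qed.
Lemma sideV c g : side c g -> side c g^-1.
Proof. exact: gen_byV. Qed.
Lemma edge1 : edge 1.
Proof. by split; exact: gen_by1. Qed.
Lemma edgeM g h : edge g -> edge h -> edge (g * h).
Proof. by case=> ? ? [? ?]; split; exact: gen_byM. Qed.
Lemma edgeV g : edge g -> edge g^-1.
Proof. by case=> ? ?; split; exact: gen_byV. Qed.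
Lemma edge_side c g : edge g -> side c g.
Proof. by case: c => -[]. Qed.
Lemma edgeMl g h : edge g -> edge (g * h) -> edge h.
Proof. by move=> eg egh; rewrite -[h](mulKg g); apply/edgeM/egh/edgeV. Qed.
Lemma edgeMr g h : edge h -> edge (g * h) -> edge g.
Proof. by move=> eh egh; rewrite -[g](mulgK h); apply/edgeM/edgeV. Qed.

Definition rep (g : A) : A := choose (fun h => `[< edge (g * h^-1) >]) g.

Lemma repP g : edge (g * (rep g)^-1).
Proof.
apply/asboolP; apply: (@chooseP _ (fun h => `[< edge (g * h^-1) >])).
by apply/asboolP; rewrite mulgV; exact: edge1.
Qed.

Lemma rep_edge g h : edge g -> rep (g * h) = rep h.
Proof.
move=> eg; rewrite /rep.
have E : (fun h0 => `[< edge (g * h * h0^-1) >]) =1 (fun h0 => `[< edge (h * h0^-1) >]).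
  move=> x; apply: asbool_equiv_eq; rewrite -mulgA.
  by split=> [/(edgeMl eg)//|]; exact: edgeM.
rewrite (eq_choose E); apply: choose_id; apply/asboolP; last by rewrite mulgV; exact: edge1.
by rewrite invgM mulgA mulgV mul1g; exact: edgeV.
Qed.

(* A normal form is a pair of an element of [edge] and a list of nontrivial right
   coset representatives, tagged by their sides, which alternate. *)
Definition head_ne (c : bool) (l : seq (bool * A)) : Prop :=
  if l is (c', _) :: _ then c != c' else True.

Fixpoint normal_list (l : seq (bool * A)) : Prop :=
  if l is (c, t) :: l' then
    [/\ side c t, ~ edge t, rep t = t, head_ne c l' & normal_list l']
  else True.

(** Van der Waerden's method: [absorb c] and [emit c] identify normal forms with pairs of an element
    of [side c] and a list not starting on side [c], on which [side c] acts by left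
    multiplication. *)
Definition absorb (c : bool) (o : A * seq (bool * A)) : A * seq (bool * A) :=
  if o.2 is (c', t) :: l then if c == c' then (o.1 * t, l) else o else o.

Definition emit (c : bool) (o : A * seq (bool * A)) : A * seq (bool * A) :=
  if `[< edge o.1 >] then o else (o.1 * (rep o.1)^-1, (c, rep o.1) :: o.2).

Definition push c g o := let: (h, l) := absorb c o in emit c (g * h, l).

Definition normal_form (o : A * seq (bool * A)) := edge o.1 /\ normal_list o.2.

Lemma absorb_head c o : normal_form o -> head_ne c (absorb c o).2.
Proof.
case: o => x [|[c' t] l] //= [_ /= [_ _ _ hl _]].
by rewrite /absorb /=; case: eqP => [->|/eqP].
Qed.

Lemma absorb_side c o : normal_form o -> side c (absorb c o).1.
Proof.
case: o => x [|[c' t] l] /=; first by case=> ex _; exact: edge_side.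
case=> ex /= [st _ _ _ _]; rewrite /absorb /=; case: eqP => [->|_] /=.
  by apply: sideM => //; exact: edge_side.
exact: edge_side.
Qed.

Lemma absorb_normal c o : normal_form o -> normal_list (absorb c o).2.
Proof.
case: o => x [|[c' t] l] //= [_ /= [? ? ? ? ?]].
by rewrite /absorb /=; case: eqP.
Qed.

Lemma emitK c h l : head_ne c l -> absorb c (emit c (h, l)) = (h, l).
Proof.
rewrite /emit /=; case: asboolP => _; last by rewrite /absorb /= eqxx mulgVK.
by case: l => // -[c' t] l; rewrite /absorb /=; case: eqP.
Qed.

Lemma absorbK c o : normal_form o -> emit c (absorb c o) = o.
Proof.
case: o => x [|[c' t] l] /=; first by case=> ex _; rewrite /emit /=; case: asboolP.
case=> ex /= [st nt rt _ _]; rewrite /absorb /=; case: eqP => [->|_] /=.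
  rewrite /emit /=; case: asboolP => [/(edgeMl ex)//|_].
  by rewrite rep_edge // rt mulgK.
by rewrite /emit /=; case: asboolP.
Qed.

Lemma pushM c g h o : normal_form o -> push c g (push c h o) = push c (g * h) o.
Proof.
move=> /(@absorb_head c); rewrite /push; case: (absorb c o) => x l hl.
by rewrite emitK // mulgA.
Qed.

Lemma push1 c o : normal_form o -> push c 1 o = o.
Proof.
move=> no; rewrite /push -{2}(absorbK c no).
by case: absorb => h l; rewrite mul1g.
Qed.

Lemma push_normal c g o : side c g -> normal_form o -> normal_form (push c g o).
Proof.
move=> sg no; move: (absorb_head c no) (absorb_side c no) (absorb_normal c no).
rewrite /push; case: absorb => h l /= hl sh nl; rewrite /emit /=.
case: asboolP => // nh; split=> /=; first exact: repP.
have e := repP (g * h).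
have sgh := sideM sg sh.
split=> //.
- rewrite -[rep _]invgK -[(rep _)^-1](mulKg (g * h)) invgM invgK.
  by apply: sideM => //; exact/sideV/edge_side.
- by move=> er; apply: nh; exact: edgeMr (edgeV er) e.
- rewrite -{2}[g * h](mulgVK (rep (g * h))).
  by rewrite (rep_edge _ e).
Qed.

(** The result does not depend on [c], so the actions of the two sides agree on their intersection,
    and a letter other than [b] and [b'] may be pushed through either side. *)
Lemma push_edge c g o : edge g -> normal_form o -> push c g o = (g * o.1, o.2).
Proof.
case: o => x l eg no; have := absorbK c no; rewrite /push.
case: no => /= ex; case: l => [|[c' t] l] /=.
  by move=> _; rewrite /absorb /emit /= !asboolT //; exact: edgeM.
case=> _ nt rt _ _; rewrite /absorb /emit /=; case: eqP => [->|_] /=.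
  case: asboolP => [/(edgeMl ex)//|_ _].
  rewrite mulgA asboolF => [|/(edgeMl (edgeM eg ex))//].
  by rewrite rep_edge ?rt ?mulgK //; exact: edgeM.
by rewrite !asboolT //; exact: edgeM.
Qed.

Definition letter_side (z : I) := z != b'.

Definition push_letter (l : I * bool) := push (letter_side l.1) (letter_val (sgen m) l).

Lemma letter_side_side l : side (letter_side l.1) (letter_val (sgen m) l).
Proof.
case: l => z e; apply: gen_by_letter; rewrite /letter_side /=.
by case: eqP => [->|] //= /esym.
Qed.

Lemma push_letter_normal l o : normal_form o -> normal_form (push_letter l o).
Proof. exact/push_normal/letter_side_side. Qed.

Lemma push_letter_side c l o : l.1 <> (if c then b' else b) -> normal_form o ->
  push_letter l o = push c (letter_val (sgen m) l) o.
Proof.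
move=> lc no; rewrite /push_letter /letter_side.
case: eqP lc => [lb'|/eqP nb'] /=; case: c => //= lb.
have e : edge (letter_val (sgen m) l).
  by case: l lb nb' => z e /= lb /eqP nb'; split; apply: gen_by_letter.
by rewrite !push_edge.
Qed.

Lemma run_side c u o : (forall l, l \in u -> l.1 <> if c then b' else b) ->
  normal_form o -> foldr push_letter o u = push c (pres_class (artin_rel m) u) o.
Proof.
move=> uc no; elim: u uc => [|l u IH] uc /=; first by rewrite push1.
have lu x : x \in u -> x.1 <> if c then b' else b.
  by move=> xu; apply: uc; rewrite inE xu orbT.
rewrite IH // (@push_letter_side c); first last.
- by apply: push_normal => //; exists u.
- exact: uc (mem_head _ _).
by rewrite pushM // -!word_val_gen.
Qed.

Lemma run_normal u o : normal_form o -> normal_form (foldr push_letter o u).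
Proof. by move=> no; elim: u => //= l u; exact: push_letter_normal. Qed.

Lemma mem_alt (T : eqType) (x y z : T) n : z \in alt x y n -> z = x \/ z = y.
Proof.
elim: n x y => //= n IH x y; rewrite mem_rcons inE.
by case/predU1P=> [->|/IH[]]; auto.
Qed.

Lemma run_amalgam u v : pres_eq (artin_rel m) u v ->
  forall o, normal_form o -> foldr push_letter o u = foldr push_letter o v.
Proof.
apply: pres_act => [l o|x e o no|_ _ [s t k st mst] o no].
- exact: push_letter_normal.
- have sx := letter_side_side (x, e).
  rewrite /push_letter /= pushM // -[RHS](push1 (letter_side x) no).
  by congr push; case: e {sx}; rewrite /letter_val /= ?mulVg ?mulgV.
have [c cs ct] : exists2 c, s <> (if c then b' else b) & t <> (if c then b' else b).
  have [sb'|nsb'] := eqVneq s b'.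
    exists false => /= h; first by case: bb'; rewrite -sb'.
    by move: mst; rewrite m_sym sb' h mbb'.
  have [tb'|ntb'] := eqVneq t b'; last by exists true; exact/eqP.
  exists false => /= h; last by case: bb'; rewrite -tb'.
  by move: mst; rewrite tb' h mbb'.
rewrite !(@run_side c) //; last first.
- by move=> l /mem_alt [->|->].
- by move=> l /mem_alt [->|->].
by congr push; apply/pres_classP/pres_rel; constructor.
Qed.

Definition nf_act (g : A) := foldr push_letter ^~ (pres_repr g).

Lemma nf_act_class u o : normal_form o ->
  nf_act (pres_class (artin_rel m) u) o = foldr push_letter o u.
Proof. by move=> no; apply: run_amalgam => //; exact: pres_repr_class. Qed.

Lemma nf_actM g h o : normal_form o -> nf_act (g * h) o = nf_act g (nf_act h o).
Proof.
have [u ->] := pres_class_surj g; have [v ->] := pres_class_surj h => no.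
by rewrite -pres_classM !nf_act_class ?foldr_cat //; exact: run_normal.
Qed.

Lemma nf_act_side c g o : side c g -> normal_form o -> nf_act g o = push c g o.
Proof. by case=> u uc -> no; rewrite nf_act_class // (@run_side c). Qed.

(* [reduced c d g]: [g] is a product of elements lying alternately in
   [side c] and [side (~~ c)], none of them in [edge], the last in [side d]. *)
Inductive reduced : bool -> bool -> A -> Prop :=
  | Reduced1 c g : side c g -> ~ edge g -> reduced c c g
  | ReducedS c d g h : side c g -> ~ edge g -> reduced (~~ c) d h ->
      reduced c d (g * h).

(** Acting on the empty normal form, each factor meets a head on the other side and hence lengthens
    the list. *)
Lemma reduced_nf_act c d g : reduced c d g ->
  exists h t l, edge h /\ nf_act g (1, [::]) = (h, (c, t) :: l).
Proof.
have n1 : normal_form (1, [::]) by split=> //; exact: edge1.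
elim=> {c d g} [c g sg ng|c d g h sg ng _ [x [t [l [ex E]]]]].
  rewrite (nf_act_side sg) // /push /emit /= mulg1.
  case: asboolP => // _; do 3!eexists; split; last by [].
  exact: repP.
rewrite nf_actM //.
have nE : normal_form (nf_act h (1, [::])) by exact: run_normal.
rewrite E in nE *; rewrite (nf_act_side sg) // /push /absorb /=.
rewrite (_ : (c == ~~ c) = false); last by case: (c).
rewrite /emit /=; case: asboolP => [/(edgeMr ex)//|_].
do 3!eexists; split; last by [].
exact: repP.
Qed.

Theorem reduced_nedge c d g : reduced c d g -> ~ edge g.
Proof.
move=> rg eg; have [h [t [l [_]]]] := reduced_nf_act rg.
have n1 : normal_form (1, [::]) by split=> //; exact: edge1.
by rewrite (nf_act_side (edge_side true eg)) // push_edge.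
Qed.

Lemma reduced_neq1 c d g : reduced c d g -> g <> 1.
Proof. by move=> /reduced_nedge ng g1; apply: ng; rewrite g1; exact: edge1. Qed.

Lemma reduced_cat c d e g h : reduced c d g -> reduced (~~ d) e h ->
  reduced c e (g * h).
Proof.
elim=> {c d g} [c g sg ng|c d g g' sg ng _ IH] rh; first exact: ReducedS.
by rewrite -mulgA; apply: ReducedS => //; exact: IH.
Qed.

Lemma reducedV c d g : reduced c d g -> reduced d c g^-1.
Proof.
have nV x : ~ edge x -> ~ edge x^-1 by move=> nx /edgeV; rewrite invgK.
elim=> {c d g} [c g sg ng|c d g g' sg ng _ IH].
  by apply: Reduced1; [exact: sideV|exact: nV].
rewrite invgM; apply: reduced_cat IH _; rewrite negbK.
by apply: Reduced1; [exact: sideV|exact: nV].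
Qed.

Lemma reduced_edgeMl c d g x : edge x -> reduced c d g -> reduced c d (x * g).
Proof.
move=> ex [{}c h sh nh|{}c {}d h h' sh nh rh']; last rewrite mulgA.
  by apply: Reduced1; [apply: sideM => //; exact: edge_side|move/(edgeMl ex)].
by apply: ReducedS => //; [apply: sideM => //; exact: edge_side|move/(edgeMl ex)].
Qed.

Lemma reduced_sideMl c g h : side c g -> edge h \/ (exists c' d, reduced c' d h) ->
  edge (g * h) \/ (exists c' d, reduced c' d (g * h)).
Proof.
move=> sg [eh|[c' [d rh]]].
  have [egh|ngh] := pselect (edge (g * h)); [by left|right].
  by exists c, c; apply: Reduced1 => //; apply: sideM => //; exact: edge_side.
have [eg|ng] := pselect (edge g).
  by right; exists c', d; exact: reduced_edgeMl.
have [cc'|cc'] := eqVneq c' (~~ c).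
  by right; exists c, d; apply: ReducedS; rewrite -?cc'.
have {cc'} cc' : c' = c by case: (c) c' cc' {rh} => -[].
move: rh; rewrite {}cc' => rh; case: rh sg ng => {c d h} [c h sh _|c d h h' sh nh rh'] sg ng.
  have [egh|ngh] := pselect (edge (g * h)); [by left|right].
  by exists c, c; apply: Reduced1 => //; exact: sideM.
right; rewrite mulgA; have [egh|ngh] := pselect (edge (g * h)).
  by exists (~~ c), d; exact: reduced_edgeMl.
by exists c, d; apply: ReducedS => //; exact: sideM.
Qed.

Lemma edge_or_reduced g : edge g \/ exists c d, reduced c d g.
Proof.
have letterP (l : I * bool) h : edge h \/ (exists c d, reduced c d h) ->
    edge (letter_val (sgen m) l * h) \/ exists c d, reduced c d (letter_val (sgen m) l * h).
  by move=> H; exact: reduced_sideMl (letter_side_side l) H.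
elim/(@pres_ind _ (artin_rel m)): g; first by left; exact: edge1.
- by move=> x h; exact: (letterP (x, false)).
- by move=> x h; exact: (letterP (x, true)).
Qed.

Lemma reduced_first c d g : reduced c d g -> c = d \/
  exists h q, [/\ side c h, ~ edge h, reduced (~~ c) d q & g = h * q].
Proof. by case=> {c d g} [c g _ _|c d g h sg ng rh]; [left|right; exists g, h]. Qed.

Lemma reduced_last c d g : reduced c d g ->
  (c = d /\ side d g) \/
  exists h q, [/\ side d q, ~ edge q, reduced c (~~ d) h & g = h * q].
Proof.
elim=> {c d g} [c g sg ng|c d g h sg ng rh [[cd sh]|[h' [q [sq nq rh' ->]]]]]; first by left.
  right; exists g, h; split=> //; last by rewrite -cd negbK; exact: Reduced1.
  exact: reduced_nedge rh.
by right; exists (g * h'), q; split=> //; [exact: ReducedS|rewrite mulgA].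
Qed.

Lemma reduced_nside c g : reduced c c g -> ~ side (~~ c) g.
Proof.
move=> rg sg; have ng := reduced_nedge rg.
have rV : reduced (~~ c) (~~ c) g^-1.
  by apply: Reduced1; [exact: sideV|move/edgeV; rewrite invgK].
by apply: (reduced_neq1 (reduced_cat rg rV)); rewrite mulgV.
Qed.

(** The product k^-1 p k is reduced around [p]. A last factor of [k] in [side (~~ c)] may be
    stripped beforehand, as conjugating by it preserves that side. *)
Lemma conj_nside c p k : side c p -> ~ edge p ->
  edge k \/ (exists d, reduced (~~ c) d k) -> ~ side (~~ c) (p ^ k).
Proof.
move=> sp np kP.
have neP x : side c x -> ~ edge x -> ~ side (~~ c) x.
  by move=> sx nx sx'; apply: nx; move: sx sx'; case: (c) => ? ?; split.
case: kP => [ek|[d rk]].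
  move=> s; apply: (neP p) => //; rewrite -[p](conjgK k) !conjgE invgK.
  by apply: sideM; [exact: edge_side|apply: sideM => //; exact/sideV/edge_side].
have ends k' : reduced (~~ c) c k' -> ~ side (~~ c) (p ^ k').
  move=> rk'; apply: reduced_nside; rewrite conjgE.
  apply: reduced_cat (reducedV rk') _; rewrite negbK.
  by apply: reduced_cat rk'; exact: Reduced1.
have [dc|dc] := eqVneq d c; first by apply: ends; rewrite -{2}dc.
have {dc} dc : d = ~~ c by move: dc; case: (d); case: (c).
have strip x q : side (~~ c) q -> side (~~ c) (x ^ q) -> side (~~ c) x.
  move=> sq sxq; rewrite -[x](conjgK q) [X in side _ X]conjgE invgK.
  by apply: sideM => //; apply: sideM => //; exact: sideV.
rewrite {}dc in rk.
case: (reduced_last rk) => [[_ sk]|[h [q [sq _ rh ->]]]].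
  by move/(strip _ _ sk); exact: neP.
rewrite conjgM => /(strip _ _ sq); apply: ends.
by rewrite negbK in rh.
Qed.

Lemma sgen_side c : let x := sgen m (if c then b else b') in
  [/\ side c x, ~ edge x & ~ edge (x * x)].
Proof.
case: c => /=.
  have [n1 n2] := sgen_nmem b; split; first exact: gen_by_gen.
  - by case.
  - by case.
have [n1 n2] := sgen_nmem b'; split; first by apply: gen_by_gen; apply: nesym.
- by case.
- by case.
Qed.

(** The first factor of [a] decides. If [a] lies in [edge] or starts on side false, [sgen m b ^ a]
    leaves side false, which contains [sgen m e] unless [e = b]; the other case is symmetric. *)
Lemma sgen_conj_rigid a e e' : a * sgen m e = sgen m b * a ->
  a * sgen m e' = sgen m b' * a -> e = b \/ e' = b'.
Proof.
move=> ae ae'; apply: contrapT => /not_orP[eb e'b'].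
have cb : sgen m b ^ a = sgen m e by rewrite conjgE -ae mulKg.
have cb' : sgen m b' ^ a = sgen m e' by rewrite conjgE -ae' mulKg.
have [st nt _] := sgen_side true; have [sf nf _] := sgen_side false.
have [ea|[[] [d ra]]] := edge_or_reduced a.
- apply: (conj_nside st nt (or_introl ea)); rewrite /= cb.
  exact: gen_by_gen.
- apply: (@conj_nside false _ a sf nf); first by right; exists d.
  by rewrite /= cb'; exact: gen_by_gen.
- apply: (@conj_nside true _ a st nt); first by right; exists d.
  by rewrite /= cb; exact: gen_by_gen.
Qed.

(** * Normal subsets and the amalgam *)

Section Normal.
Variable N : A -> Prop.
Hypothesis NV : forall g, N g -> N g^-1.
Hypothesis NJ : forall g h, N g -> N (g ^ h).

(** Conjugating by elements of [side c] outside [edge] arranges both ends of a reduced product; if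
    one end is already on side [c], the conjugator must not be absorbed there. *)
Lemma normal_reduced c n : N n -> ~ edge n -> exists2 u, N u & reduced c c u.
Proof.
move=> Nn nn; have [//|[c0 [d0 rn]]] := edge_or_reduced n.
have [sx nx nxx] := sgen_side c; set x := sgen m _ in sx nx nxx.
have rx : reduced c c x by exact: Reduced1.
have mixed n' : N n' -> reduced c (~~ c) n' -> exists2 u, N u & reduced c c u.
  move=> Nn' rn'.
  have [y ry syn] : exists2 y, reduced c c y & reduced c (~~ c) (y * n').
    (* For the first factor [g], the elements [x^-1 * g] and [x * g] cannot both lie in [edge],
       since [x * x] does not; so [x^-1] or [x] serves as conjugator. *)
    have [y sy [ny]] : exists2 y, side c y & ~ edge y /\
        (forall g, side c g -> edge (y * g) -> ~ edge (x * g)).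
      exists x^-1; first exact: sideV.
      split=> [/edgeV|g sg e1 e2]; first by rewrite invgK.
      by apply: nxx; have := edgeM e2 (edgeV e1); rewrite invgM invgK mulgA mulgK.
    case: (reduced_first rn') => [|[g [h [sg _ rh ->]]]]; first by case: (c).
    have [egh|ngh] := pselect (edge (y * g)) => nxg.
      exists x => //; rewrite mulgA; apply: ReducedS => //; first exact: sideM.
      exact: nxg.
    exists y; first exact: Reduced1.
    by rewrite mulgA; apply: ReducedS => //; exact: sideM.
  exists (n' ^ y^-1); first exact: NJ.
  rewrite conjgE invgK mulgA; apply: reduced_cat syn _; rewrite negbK.
  exact: reducedV.
have [c0c|c0c] : c0 = c \/ c0 = ~~ c by case: (c0); case: (c); auto.
  have [d0c|d0c] : d0 = c \/ d0 = ~~ c by case: (d0); case: (c); auto.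
    by exists n => //; move: rn; rewrite c0c d0c.
  by apply: mixed Nn _; move: rn; rewrite c0c d0c.
have [d0c|d0c] : d0 = c \/ d0 = ~~ c by case: (d0); case: (c); auto.
  by apply: mixed (NV Nn) _; apply: reducedV; move: rn; rewrite c0c d0c.
exists (n ^ x^-1); first exact: NJ.
rewrite conjgE invgK; apply: (reduced_cat rx).
apply: (@reduced_cat _ (~~ c)); last by rewrite negbK; exact: reducedV.
by move: rn; rewrite c0c d0c.
Qed.

(* Membership in the complementary parabolic subgroups propagates along pairs of
   generators with infinite label. *)
Lemma normal_transfer n : N n -> ~ gen_by (fun z => z <> b) n ->
  exists2 n', N n' & ~ gen_by (fun z => z <> b') n'.
Proof.
move=> Nn nn; apply: contrapT => noN.
have Nb' n' : N n' -> side true n'.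
  by move=> Nn'; apply: contrapT => h; apply: noN; exists n'.
have ne : ~ edge n by case.
have [sx nx _] := sgen_side false; set x := sgen m _ in sx nx.
have rx : reduced false false x by exact: Reduced1.
have : reduced false false (n ^ x^-1).
  rewrite conjgE invgK; apply: (reduced_cat rx).
  apply: (@reduced_cat true true); last exact: reducedV.
  by apply: Reduced1 => //; exact: Nb'.
by move/reduced_nside; apply; exact/Nb'/NJ.
Qed.

End Normal.

(** Otherwise there are [u] in [N] and [v] in [N'], reduced with both ends on side true and side
    false respectively, and their commutator is a nontrivial reduced product. *)
Lemma commuting_normal (N N' : A -> Prop) n n' :
  (forall g, N g -> N g^-1) -> (forall g h, N g -> N (g ^ h)) ->
  (forall g, N' g -> N' g^-1) -> (forall g h, N' g -> N' (g ^ h)) ->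
  (forall g h, N g -> N' h -> g * h = h * g) ->
  N n -> N' n' -> edge n \/ edge n'.
Proof.
move=> NV NJ NV' NJ' NN' Nn Nn'; apply: contrapT => /not_orP[en en'].
have [u Nu ru] := normal_reduced NV NJ true Nn en.
have [v Nv rv] := normal_reduced NV' NJ' false Nn' en'.
have := reduced_cat (reduced_cat ru rv) (reduced_cat (reducedV ru) (reducedV rv)).
move/reduced_neq1; apply; rewrite (NN' u v) // -mulgA.
by rewrite [u * _]mulgA mulgV mul1g mulgV.
Qed.

End Amalgam.
End GenBy.

(** * The kernel of the projection to the Coxeter group *)

Section VirtualArtin.
Variables (S : countType) (M : coxeter_matrix S).

Local Notation W := (cox M).
Local Notation r := (rgen M).

Let m_sym : forall s t, M s t = M t s. Proof. exact: cox_sym. Qed.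
Let m_gt1 : forall s t k, s != t -> M s t = Some k -> (1 < k)%N.
Proof. exact: cox_off. Qed.

Definition lprod (H : groupType) (f : S -> H) (u : seq S) : H :=
  foldr (fun s h => f s * h) 1 u.

Lemma lprodE (H : groupType) (f : va_gen S -> H) (g : S -> va_gen S) u :
  word_val f (map (fun s => letter (g s)) u) = lprod (fun s => f (g s)) u.
Proof. by elim: u => //= s u ->. Qed.

Lemma lprod_alt (H : groupType) (f : S -> H) s t k :
  lprod f (alt s t k) = lprod f (alt t s k) <-> galt (f s) (f t) k = galt (f t) (f s) k.
Proof.
have E a b n : lprod f (altl a b n) = galt (f a) (f b) n.
  by elim: n a b => //= n IH a b; rewrite IH.
by rewrite !altE; case: odd; rewrite !E; split=> ->.
Qed.

Section VaHom.
Variables (H : groupType) (f : va_gen S -> H).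
Hypothesis f_sigma : forall s t k, s != t -> M s t = Some k ->
  galt (f (inl s)) (f (inl t)) k = galt (f (inl t)) (f (inl s)) k.
Hypothesis f_tau : forall s t k, s != t -> M s t = Some k ->
  galt (f (inr s)) (f (inr t)) k = galt (f (inr t)) (f (inr s)) k.
Hypothesis f_sq : forall s, f (inr s) * f (inr s) = 1.
Hypothesis f_mix : forall s t k, s != t -> M s t = Some k ->
  lprod (f \o inr) (alt s t k.-1) * f (inl t) =
  f (inl (if odd k then s else t)) * lprod (f \o inr) (alt s t k.-1).

Lemma va_hom_rel u v : va_rel M u v -> word_val f u = word_val f v.
Proof.
case=> [s t k st mst|s t k st mst|s|s t k st mst].
- rewrite -!(map_alt (fun s => letter (inl s : va_gen S))) !lprodE.
  by apply/lprod_alt; exact: f_sigma.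
- rewrite -!(map_alt (fun s => letter (inr s : va_gen S))) !lprodE.
  by apply/lprod_alt; exact: f_tau.
- by rewrite /= mulg1; exact: f_sq.
- rewrite -cats1 word_val_cat /= /letter_val /= mulg1.
  rewrite -(map_alt (fun s => letter (inr s : va_gen S))) lprodE.
  exact: f_mix.
Qed.
End VaHom.

Lemma sigma_braid s t k : s != t -> M s t = Some k ->
  galt (sigma M s) (sigma M t) k = galt (sigma M t) (sigma M s) k.
Proof.
move=> st mst; apply/(word_val_alt_eq (X := va_gen S) (gen (va_rel M)) (inl s) (inl t)).
by rewrite !word_val_gen; apply/pres_classP/pres_rel/VA1.
Qed.

Lemma tau_braid s t k : s != t -> M s t = Some k ->
  galt (tau M s) (tau M t) k = galt (tau M t) (tau M s) k.
Proof.
move=> st mst; apply/(word_val_alt_eq (X := va_gen S) (gen (va_rel M)) (inr s) (inr t)).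
by rewrite !word_val_gen; apply/pres_classP/pres_rel/VA2.
Qed.

Lemma tau_sq s : tau M s * tau M s = 1.
Proof. by rewrite -pres_classM; apply/pres_classP/pres_rel/VA2_sq. Qed.

Lemma tauV s : (tau M s)^-1 = tau M s.
Proof. exact/mulg1_eq/tau_sq. Qed.

Lemma sigma_tau_mix s t k : s != t -> M s t = Some k ->
  lprod (tau M) (alt s t k.-1) * sigma M t =
  sigma M (if odd k then s else t) * lprod (tau M) (alt s t k.-1).
Proof.
move=> st mst.
have E u : lprod (tau M) u = pres_class (va_rel M) (map (@tau_l S) u).
  by rewrite -word_val_gen (lprodE (gen (va_rel M)) inr).
rewrite E -!pres_classM map_alt; apply/pres_classP; rewrite cats1 /=.
exact/pres_rel/VA3.
Qed.

Lemma va_ind (Q : VA M -> Prop) : Q 1 ->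
  (forall s g, Q g -> Q (sigma M s * g)) ->
  (forall s g, Q g -> Q ((sigma M s)^-1 * g)) ->
  (forall s g, Q g -> Q (tau M s * g)) -> forall g, Q g.
Proof.
move=> Q1 Qs QsV Qt; apply: pres_ind => // -[s|s] g Qg; first exact: Qs.
- exact: Qt.
- exact: QsV.
- by have := Qt s g Qg; rewrite -{1}tauV.
Qed.

Lemma iota_rel u v : cox_rel M u v -> word_val (tau M) u = word_val (tau M) v.
Proof.
case=> [s t k st mst|s]; last by rewrite /= mulg1; exact: tau_sq.
by apply/word_val_alt_eq; exact: tau_braid.
Qed.

Definition iota : W -> VA M := pres_hom iota_rel.

Lemma iotaM : {morph iota : g h / g * h}. Proof. exact: pres_homM. Qed.
Lemma iota_gen s : iota (r s) = tau M s. Proof. exact: pres_hom_gen. Qed.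

Lemma iota_cword u : iota (cword M u) = lprod (tau M) u.
Proof.
elim: u => [|s u IH] /=; first exact: (morph_group1 iotaM).
by rewrite iotaM IH iota_gen.
Qed.

Lemma piK_rel u v : va_rel M u v ->
  word_val (fun x : va_gen S => match x with inl _ => 1 | inr s => r s end) u =
  word_val (fun x : va_gen S => match x with inl _ => 1 | inr s => r s end) v.
Proof.
apply: va_hom_rel => // [s t k st mst|s|s t k st mst].
- exact: rgen_braid.
- exact: rgen_sq.
- by rewrite mulg1 mul1g.
Qed.

Definition piK : VA M -> W := pres_hom piK_rel.

Lemma piKM : {morph piK : g h / g * h}. Proof. exact: pres_homM. Qed.
Lemma piK_sigma s : piK (sigma M s) = 1. Proof. exact: pres_hom_gen. Qed.
Lemma piK_tau s : piK (tau M s) = r s. Proof. exact: pres_hom_gen. Qed.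

Lemma piK_iota w : piK (iota w) = w.
Proof.
apply: (pres_hom_ext (f := piK \o iota) (g := id)) => // [u v|s] /=.
  by rewrite iotaM piKM.
by rewrite -/(r s) iota_gen piK_tau.
Qed.

(* A root [w alpha_s] is recorded by the generator [w sigma_s w^-1] of the
   kernel, by the reflection [w s w^-1] and by its sign ([true] if negative). *)
Definition root_data := (VA M * W * bool)%type.

Definition dact (w : W) (y : root_data) : root_data :=
  (y.1.1 ^ (iota w)^-1, y.1.2 ^ w^-1, y.2 (+) par w^-1 y.1.2).

Lemma dact1 y : dact 1 y = y.
Proof.
case: y => [[g t] e]; rewrite /dact (morph_group1 iotaM) !invg1 !conjg1 /=.
by rewrite par1 addbF.
Qed.

Lemma dactM u v y : dact (u * v) y = dact u (dact v y).
Proof.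
case: y => [[g t] e]; rewrite /dact iotaM !invgM /= !conjgM parM.
by rewrite addbA.
Qed.

Definition dsimple (s : S) : root_data := (sigma M s, r s, false).

(** With the conjugate of sigma_s in the datum, [delta] is well defined by construction, without a
    description of the stabilizers of roots in W. *)
Definition va_root :=
  {y : root_data | `[< exists w s, y = dact w (dsimple s) >]}.

Lemma ract_subproof w (b : va_root) :
  `[< exists v s, dact w (val b) = dact v (dsimple s) >].
Proof.
case: b => y /= /asboolP[v [s ->]]; apply/asboolP.
by exists (w * v), s; rewrite dactM.
Qed.

Definition root_act w (b : va_root) : va_root := Sub (dact w (val b)) (ract_subproof w b).

Lemma simple_subproof s : `[< exists v t, dsimple s = dact v (dsimple t) >].
Proof. by apply/asboolP; exists 1, s; rewrite dact1. Qed.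

Definition simple_root s : va_root := Sub (dsimple s) (simple_subproof s).

Lemma ract1 b : root_act 1 b = b.
Proof. by apply: val_inj; exact: dact1. Qed.

Lemma ractM u v b : root_act (u * v) b = root_act u (root_act v b).
Proof. by apply: val_inj; exact: dactM. Qed.

Lemma ractK w : cancel (root_act w) (root_act w^-1).
Proof. by move=> b; rewrite -ractM mulVg ract1. Qed.

Lemma root_act_inj w : injective (root_act w).
Proof. exact: can_inj (ractK w). Qed.

Lemma root_simple (b : va_root) : exists w s, b = root_act w (simple_root s).
Proof.
have /asboolP[w [s e]] := valP b.
by exists w, s; apply: val_inj.
Qed.

Definition root_refl (b : va_root) : W := (val b).1.2.
Definition delta (b : va_root) : VA M := (val b).1.1.
Definition opp_root b := root_act (root_refl b) b.

Lemma refl_ract w b : root_refl (root_act w b) = root_refl b ^ w^-1. Proof. by []. Qed.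
Lemma refl_simple s : root_refl (simple_root s) = r s. Proof. by []. Qed.
Lemma delta_ract w b : delta (root_act w b) = delta b ^ (iota w)^-1. Proof. by []. Qed.
Lemma delta_simple s : delta (simple_root s) = sigma M s. Proof. by []. Qed.

Lemma opp_ract w b : opp_root (root_act w b) = root_act w (opp_root b).
Proof.
by rewrite /opp_root refl_ract -!ractM conjgE invgK mulgA mulgVK.
Qed.

Lemma opp_simple s : opp_root (simple_root s) = root_act (r s) (simple_root s). Proof. by []. Qed.

Lemma refl_sq b : root_refl b * root_refl b = 1.
Proof.
have [w [s ->]] := root_simple b.
by rewrite refl_ract -conjMg refl_simple rgen_sq conj1g.
Qed.

Lemma oppK : involutive opp_root.
Proof. by move=> b; rewrite {2}/opp_root opp_ract /opp_root -ractM refl_sq ract1. Qed.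

Lemma simple_inj : injective simple_root.
Proof. by move=> s t /(congr1 root_refl); rewrite !refl_simple => /(rgen_inj m_sym m_gt1). Qed.

Lemma opp_neq b : opp_root b <> b.
Proof.
have [w [s ->]] := root_simple b; rewrite opp_ract => /root_act_inj /(congr1 val) /=.
by case=> _ _; rewrite rgenV par_gen eqxx.
Qed.

Lemma root_act_mix s t k : s != t -> M s t = Some k ->
  root_act (cword M (alt s t k.-1)) (simple_root t) = simple_root (if odd k then s else t).
Proof.
move=> st mst; apply: val_inj; rewrite /= /dact /dsimple /=; congr (_, _, _).
- by rewrite conjgE invgK mulgA iota_cword sigma_tau_mix // mulgK.
- by rewrite conjgE invgK mulgA (va3_refl m_gt1 st mst) mulgK.
- exact/negbTE/(va3_par m_sym m_gt1 st mst).
Qed.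

Lemma ract_commute s t : M s t = Some 2 -> root_act (r t) (simple_root s) = simple_root s.
Proof.
move=> mst; have ts : t != s.
  by apply/eqP => e; move: mst; rewrite e cox_diag.
have mts : M t s = Some 2 by rewrite m_sym.
by have := root_act_mix ts mts; rewrite /= mulg1.
Qed.

Lemma ract_trivial w : (forall s, root_act w (simple_root s) = simple_root s) -> w = 1.
Proof.
move=> w1; suff wV : w^-1 = 1 by rewrite -[w]invgK wV invg1.
apply: par_eq0 => s.
by have := congr1 val (w1 s); case=> _ _ /= ->.
Qed.

(** * Labels on roots *)

Definition label_wit (b c : va_root) (o : option nat) : Prop := exists w s t,
  [/\ s != t, b = root_act w (simple_root s), c = root_act w (simple_root t) & o = M s t].

Lemma label_wit_refl b c o : label_wit b c o -> exists s t,
  [/\ s != t, o = M s t & forall n, (r s * r t) ^+ n = 1 <-> (root_refl b * root_refl c) ^+ n = 1].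
Proof.
case=> w [s [t [st -> -> ->]]]; exists s, t; split=> // n.
rewrite !refl_ract !refl_simple -conjMg -conjXg.
by split=> [->|/eqP]; rewrite ?conj1g // conjg_eq1 => /eqP.
Qed.

(** The label is read off from the order of the product of the two reflections, which does not
    involve the witness. *)
Lemma label_wit_uniq b c o o' : label_wit b c o -> label_wit b c o' -> o = o'.
Proof.
move=> /label_wit_refl[s [t [st -> E]]] /label_wit_refl[s' [t' [st' -> E']]].
apply: (rgen_order_label m_sym m_gt1) => // n.
by rewrite E E'.
Qed.

Definition mhat (b c : va_root) : option nat :=
  if pselect (exists o, label_wit b c o) is left h then projT1 (cid h) else None.

Lemma mhatP b c o : label_wit b c o -> mhat b c = o.
Proof.
move=> h; rewrite /mhat; case: pselect => [h'|[]]; last by exists o.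
by case: cid => o' /= /label_wit_uniq /(_ h).
Qed.

Lemma mhat_Some b c k : mhat b c = Some k -> label_wit b c (Some k).
Proof. by rewrite /mhat; case: pselect => // h; case: cid => o /= ho oS; rewrite -oS. Qed.

Lemma mhat_ext b c b' c' : (forall o, label_wit b c o <-> label_wit b' c' o) ->
  mhat b c = mhat b' c'.
Proof.
move=> E; case e: (mhat b c) => [k|].
  by apply/esym/mhatP/E/mhat_Some.
case e': (mhat b' c') => [k|//].
by rewrite -e; apply/mhatP/E/mhat_Some.
Qed.

Lemma mhat_sym b c : mhat b c = mhat c b.
Proof.
apply: mhat_ext => o.
by split=> -[w [s [t [st -> -> ->]]]]; exists w, t, s; rewrite eq_sym.
Qed.

Lemma mhat_gt1 b c k : b != c -> mhat b c = Some k -> (1 < k)%N.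
Proof. by move=> _ /mhat_Some[w [s [t [st _ _ /esym]]]]; exact: m_gt1. Qed.

Lemma mhat_ract w b c : mhat (root_act w b) (root_act w c) = mhat b c.
Proof.
have E v b' c' o : label_wit b' c' o -> label_wit (root_act v b') (root_act v c') o.
  case=> u [s [t [st -> -> ->]]]; exists (v * u), s, t.
  by rewrite !ractM.
apply: mhat_ext => o; split; last exact: E.
by move/(E w^-1); rewrite !ractK.
Qed.

Lemma mhat_simple s t : s != t -> mhat (simple_root s) (simple_root t) = M s t.
Proof. by move=> st; apply: mhatP; exists 1, s, t; rewrite !ract1. Qed.

(** Opposite roots have the same reflection, while a finite label requires two distinct ones. *)
Lemma mhat_opp b : mhat b (opp_root b) = None.
Proof.
case E: mhat => [k|//]; have [w [s [t [st bs bt _]]]] := mhat_Some E.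
have : root_refl b = root_refl (opp_root b) by rewrite /opp_root refl_ract conjgE invgK mulgV mulg1.
rewrite bt bs !refl_ract => /conjg_inj /(rgen_inj m_sym m_gt1) e.
by rewrite e eqxx in st.
Qed.

Lemma mhat_obtuse s t k : s != t -> M s t = Some k -> (2 < k)%N ->
  mhat (simple_root s) (opp_root (simple_root t)) = None.
Proof.
move=> st mst k2; case E: mhat => [n|//].
have [w [s' [t' [st' es et _]]]] := mhat_Some E; exfalso.
(* Applying [r t] turns the pair alpha_s, -alpha_t into t alpha_s, alpha_t, the pair excluded by
   [obtuse_pair]. *)
pose u := r t * w.
have us : root_act u (simple_root s') = root_act (r t) (simple_root s) by rewrite /u ractM -es.
have ut : root_act u (simple_root t') = simple_root t.
  by rewrite /u ractM -et opp_simple -ractM rgen_sq ract1.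
have rst : r s != r t by rewrite (inj_eq (rgen_inj m_sym m_gt1)).
have conj_eq (v x y : W) : x ^ v^-1 = y -> v * x = y * v.
  by move=> <-; rewrite conjgE invgK !mulgA mulgVK.
have [_ us2 us3] : [/\ True, r s' ^ u^-1 = r s ^ r t & par u^-1 (r s') = false].
  have /(congr1 val) := us; case=> _ e1 e2; split=> //.
    by rewrite -[r s']/(root_refl (simple_root s')) e1 rgenV.
  by rewrite e2 rgenV par_gen (negPf rst).
have [_ ut2 ut3] : [/\ True, r t' ^ u^-1 = r t & par u^-1 (r t') = false].
  by have /(congr1 val) := ut; case.
apply: (obtuse_pair m_sym m_gt1 st mst k2 (conj_eq _ _ _ ut2) _ (conj_eq _ _ _ us2)).
  by rewrite ut3.
by rewrite us3.
Qed.

Local Notation A := (artin mhat).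

Lemma wact_rel w u v : artin_rel mhat u v ->
  word_val (fun b => sgen mhat (root_act w b)) u = word_val (fun b => sgen mhat (root_act w b)) v.
Proof.
case=> b c k bc mbc; apply/word_val_alt_eq; apply: sgen_braid.
  by rewrite (inj_eq (@root_act_inj w)).
by rewrite mhat_ract.
Qed.

Definition wact w : A -> A := pres_hom (wact_rel w).

Lemma wactMr w : {morph wact w : a b / a * b}. Proof. exact: pres_homM. Qed.
Lemma wact_gen w b : wact w (sgen mhat b) = sgen mhat (root_act w b).
Proof. exact: pres_hom_gen. Qed.

Lemma wact1 a : wact 1 a = a.
Proof.
apply: (pres_hom_ext (g := id) (@wactMr 1)) => // b.
by rewrite -/(sgen mhat b) wact_gen ract1.
Qed.

Lemma wactM v w a : wact (v * w) a = wact v (wact w a).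
Proof.
apply: (pres_hom_ext (g := wact v \o wact w) (@wactMr _)) => [x y|b] /=.
  by rewrite !wactMr.
by rewrite -/(sgen mhat b) !wact_gen ractM.
Qed.

Lemma kappa_rel u v : artin_rel mhat u v -> word_val delta u = word_val delta v.
Proof.
case=> b c k bc /mhat_Some[w [s [t [st -> -> mst]]]].
apply/word_val_alt_eq; rewrite !delta_ract !delta_simple -!galtJ.
by rewrite sigma_braid.
Qed.

Definition kappa : A -> VA M := pres_hom kappa_rel.

Lemma kappaM : {morph kappa : a b / a * b}. Proof. exact: pres_homM. Qed.
Lemma kappa_gen b : kappa (sgen mhat b) = delta b. Proof. exact: pres_hom_gen. Qed.

Lemma kappa_wact w a : kappa (wact w a) = kappa a ^ (iota w)^-1.
Proof.
apply: (pres_hom_ext (f := kappa \o wact w) (g := fun a => kappa a ^ (iota w)^-1)).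
- by move=> x y /=; rewrite wactMr kappaM.
- by move=> x y /=; rewrite kappaM conjMg.
- by move=> b /=; rewrite -/(sgen mhat b) wact_gen !kappa_gen delta_ract.
Qed.

(* VA acts on its kernel, identified with A: sigma_s by left multiplication and
   tau_s by permutation of the generators. *)
Definition vact_letter (l : va_gen S * bool) (a : A) : A :=
  match l.1 with
  | inl s => letter_val (sgen mhat) (simple_root s, l.2) * a
  | inr s => wact (r s) a
  end.

Lemma vact_sigma_word u a :
  foldr vact_letter a (map (@sigma_l S) u) = lprod (fun s => sgen mhat (simple_root s)) u * a.
Proof.
by elim: u => [|s u IH] /=; rewrite ?mul1g // IH /vact_letter /= mulgA.
Qed.

Lemma vact_tau_word u a :
  foldr vact_letter a (map (@tau_l S) u) = wact (cword M u) a.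
Proof. by elim: u => [|s u IH] /=; rewrite ?wact1 // IH /vact_letter /= wactM. Qed.

Lemma vact_pres u v : pres_eq (va_rel M) u v ->
  forall a, foldr vact_letter a u = foldr vact_letter a v.
Proof.
move=> uv a; apply: (pres_act (V := fun=> True) _ _ _ uv) => // [[s|s] e {}a _|].
- by rewrite /vact_letter /letter_val /= mulgA; case: e; rewrite /= ?mulVg ?mulgV mul1g.
- by rewrite /vact_letter /= -wactM rgen_sq wact1.
move=> _ _ [s t k st mst|s t k st mst|s|s t k st mst] {}a _.
- rewrite -!(map_alt (@sigma_l S)) !vact_sigma_word; congr (_ * _).
  apply/lprod_alt/sgen_braid; last by rewrite mhat_simple.
  by rewrite (inj_eq simple_inj).
- rewrite -!(map_alt (@tau_l S)) !vact_tau_word.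
  by rewrite (cword_alt_braid st mst).
- by rewrite /= /vact_letter /= -wactM rgen_sq wact1.
- rewrite -cats1 foldr_cat /= -(map_alt (@tau_l S)) !vact_tau_word /vact_letter /=.
  by rewrite wactMr wact_gen (root_act_mix st mst).
Qed.

Definition vact (g : VA M) (a : A) : A := foldr vact_letter a (pres_repr g).

Lemma vact_class u a : vact (pres_class (va_rel M) u) a = foldr vact_letter a u.
Proof. exact/vact_pres/pres_repr_class. Qed.

Lemma vactM g h a : vact (g * h) a = vact g (vact h a).
Proof.
have [u ->] := pres_class_surj g; have [v ->] := pres_class_surj h.
by rewrite -pres_classM !vact_class foldr_cat.
Qed.

Lemma vact1 a : vact 1 a = a. Proof. exact: (vact_class [::]). Qed.

Lemma vact_sigma s a : vact (sigma M s) a = sgen mhat (simple_root s) * a.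
Proof. exact: vact_class. Qed.

Lemma vact_tau s a : vact (tau M s) a = wact (r s) a.
Proof. exact: vact_class. Qed.

Lemma vact_iota w a : vact (iota w) a = wact w a.
Proof.
have [u ->] := cword_surj w; elim: u a => [|s u IH] a /=.
  by rewrite (morph_group1 iotaM) vact1 wact1.
by rewrite iotaM vactM IH iota_gen vact_tau wactM.
Qed.

Lemma vact_kappa b a : vact (kappa b) a = b * a.
Proof.
have gen_case c x : vact (delta c) x = sgen mhat c * x.
  have [w [s ->]] := root_simple c; rewrite delta_ract delta_simple conjgE invgK.
  rewrite !vactM vact_iota -(morph_groupV iotaM) vact_iota vact_sigma.
  by rewrite wactMr wact_gen -wactM mulgV wact1.
elim/(@pres_ind _ (artin_rel mhat)): b a => [a|c b IH a|c b IH a].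
- by rewrite (morph_group1 kappaM) vact1 mul1g.
- by rewrite kappaM vactM IH kappa_gen gen_case mulgA.
- rewrite kappaM vactM IH (morph_groupV kappaM) kappa_gen -mulgA.
  apply: (mulgI (sgen mhat c)); rewrite -gen_case -vactM mulgV vact1.
  by rewrite mulVKg.
Qed.

(** The action recovers [a] as the image of 1 under [kappa a]. *)
Lemma kappa_inj : injective kappa.
Proof. by move=> a b ab; rewrite -[a]mulg1 -vact_kappa ab vact_kappa mulg1. Qed.

Lemma piK_kappa a : piK (kappa a) = 1.
Proof.
apply: (pres_hom_ext (f := piK \o kappa) (g := fun=> 1)).
- by move=> x y /=; rewrite kappaM piKM.
- by move=> x y; rewrite mulg1.
move=> b /=; rewrite -/(sgen mhat b) kappa_gen; have [w [s ->]] := root_simple b.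
by rewrite delta_ract (morph_groupJ piKM) delta_simple piK_sigma conj1g.
Qed.

Lemma kappa_iota g : exists a w, g = kappa a * iota w.
Proof.
elim/va_ind: g => [|s g [a [w ->]]|s g [a [w ->]]|s g [a [w ->]]].
- by exists 1, 1; rewrite (morph_group1 kappaM) (morph_group1 iotaM) mulg1.
- exists (sgen mhat (simple_root s) * a), w.
  by rewrite kappaM kappa_gen delta_simple mulgA.
- exists ((sgen mhat (simple_root s))^-1 * a), w.
  by rewrite kappaM (morph_groupV kappaM) kappa_gen delta_simple mulgA.
- exists (wact (r s) a), (r s * w).
  by rewrite kappa_wact iotaM iota_gen conjgE invgK -!mulgA mulKg.
Qed.

Lemma piK1 g : piK g = 1 -> exists a, g = kappa a.
Proof.
have [a [w ->]] := kappa_iota g; rewrite piKM piK_kappa piK_iota mul1g => ->.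
by exists a; rewrite (morph_group1 iotaM) mulg1.
Qed.

Lemma normal_gen_by (N : A -> Prop) b n : (forall g h, N g -> N (g ^ h)) ->
  N n -> ~ gen_by (fun z => z <> b) n ->
  exists2 n', N n' & ~ gen_by (fun z => z <> opp_root b) n'.
Proof.
move=> NJ Nn nn; apply: (normal_transfer mhat_sym mhat_gt1 _ _ NJ Nn nn).
  exact/nesym/opp_neq.
exact: mhat_opp.
Qed.

Lemma artin_root_center a : (forall b, a * sgen mhat b = sgen mhat b * a) -> a = 1.
Proof.
move=> ca; apply: contrapT => a1.
have ca' x : a * x = x * a.
  elim/(@pres_ind _ (artin_rel mhat)): x => [|c x IH|c x IH].
  - by rewrite mulg1 mul1g.
  - by rewrite mulgA [a * _]ca -!mulgA IH.
  - rewrite mulgA -!mulgA -IH !mulgA; congr (_ * _).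
    by apply: (mulgI (gen (artin_rel mhat) c)); rewrite mulVKg mulgA -[_ c * a]ca mulgK.
(* As [a] is central, this set is closed under conjugation and commutes with everything, while
   neither [a] nor [sgen mhat b] lies in the edge group of the amalgam for b, -b. *)
pose N x := x = a \/ x = a^-1.
have NV x : N x -> N x^-1 by case=> ->; [right|left; rewrite invgK].
have NJ x y : N x -> N (x ^ y).
  by case=> ->; [left|right]; rewrite ?conjVg conjgE ca' mulKg.
have aT : gen_by (fun=> True) a by have [u ->] := pres_class_surj a; exists u.
have [b _ ab] := gen_by_neq1 mhat_sym mhat_gt1 aT a1.
have [a' Na' ab'] := normal_gen_by NJ (or_introl erefl) ab.
have a'a : a' = a \/ a' = a^-1 by [].
have bb' : b <> opp_root b by apply: nesym; exact: opp_neq.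
have [n1 _] := sgen_nmem mhat_sym mhat_gt1 b.
have := @commuting_normal _ _ mhat_sym mhat_gt1 b (opp_root b) bb' (mhat_opp b) N (fun=> True)
  a (sgen mhat b) NV NJ _ _ _ (or_introl erefl) I.
case=> // [x y [->|->] _|[_ h]|[_ h]] //.
by apply: (mulgI a); apply: (mulIg a); rewrite mulVKg -!mulgA mulVg mulg1 ca'.
Qed.

(** Writing g = [kappa a * iota w], the element [a] conjugates the generator of w b to that of b for
    every b. Rigidity on the pair b, -b forces w b = b, whence w = 1 and [a] is central. *)
Lemma centralizer_kappa g : (forall b, g * delta b = delta b * g) -> g = 1.
Proof.
have [a [w ->]] := kappa_iota g => cg.
have ca b : a * sgen mhat (root_act w b) = sgen mhat b * a.
  apply: kappa_inj; rewrite !kappaM !kappa_gen delta_ract conjgE invgK.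
  apply: (mulIg (iota w)); rewrite -[RHS]mulgA -cg.
  by rewrite !mulgA mulgVK.
have wb b : root_act w b = b.
  have [//|] := sgen_conj_rigid mhat_sym mhat_gt1 (nesym (@opp_neq b)) (mhat_opp b) (ca b) (ca (opp_root b)).
  by rewrite -opp_ract => /(can_inj oppK).
have -> : w = 1 by apply: ract_trivial => s; exact: wb.
rewrite (morph_group1 iotaM) mulg1.
suff -> : a = 1 by exact: (morph_group1 kappaM).
by apply: artin_root_center => b; rewrite -{1}(wb b) ca.
Qed.

End VirtualArtin.

(** * Connected components and automorphisms *)

Section Components.
Variables (S : countType) (M : coxeter_matrix S) (k : nat) (Gam : 'I_k -> set S).
Hypothesis hGam : connected_components M Gam.

Local Notation r := (rgen M).
Local Notation A := (artin (mhat (M := M))).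
Local Notation sg := (sgen (mhat (M := M))).

Let m_sym : forall s t, M s t = M t s. Proof. exact: cox_sym. Qed.
Let m_gt1 : forall s t k, s != t -> M s t = Some k -> (1 < k)%N.
Proof. exact: cox_off. Qed.
Let h_sym := @mhat_sym S M.
Let h_gt1 := @mhat_gt1 S M.

Lemma component_refl s : component M s s.
Proof. by exists [::]. Qed.

Lemma cox_edge_sym s t : cox_edge M s t = cox_edge M t s.
Proof. by rewrite /cox_edge eq_sym m_sym. Qed.

Lemma component_trans s t u : component M s t -> component M t u -> component M s u.
Proof.
move=> [p sp ->] [q tq ->]; exists (p ++ q); last by rewrite last_cat.
by rewrite cat_path sp.
Qed.

Lemma component_sym s t : component M s t -> component M t s.
Proof.
move=> [p sp ->]; exists (rev (belast s p)).
  rewrite rev_path; apply: sub_path sp => x y; by rewrite cox_edge_sym.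
by case: p {sp} => //= x p; rewrite rev_cons last_rcons.
Qed.

Lemma component_eq s t : component M s t -> component M s = component M t.
Proof.
move=> st; apply/seteqP; split=> u; apply: component_trans => //.
exact: component_sym.
Qed.

Lemma Gam_ex s : exists i, Gam i s.
Proof.
have [_ E] := hGam; have : range Gam (component M s) by rewrite E; exists s.
by case=> i _ e; exists i; rewrite e; exact: component_refl.
Qed.

Definition comp_idx s : 'I_k := projT1 (cid (Gam_ex s)).

Lemma Gam_component i s : Gam i s -> Gam i = component M s.
Proof.
have [_ E] := hGam; have : range (component M) (Gam i) by rewrite -E; exists i.
by case=> a _ <-; exact: component_eq.
Qed.

Lemma GamE i s : Gam i s <-> comp_idx s = i.
Proof.
rewrite /comp_idx; case: cid => j /= js; split=> [is_|<- //].
have [inj _] := hGam; apply: inj.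
by rewrite (Gam_component js) (Gam_component is_).
Qed.

Lemma comp_surj i : exists s, comp_idx s = i.
Proof.
have [_ E] := hGam; have : range (component M) (Gam i) by rewrite -E; exists i.
case=> s _ e; exists s; apply/GamE; rewrite -e; exact: component_refl.
Qed.

Lemma comp_path s t : comp_idx s = comp_idx t -> exists2 p, path (cox_edge M) s p & t = last s p.
Proof.
by move/esym/GamE; have /GamE/Gam_component -> : comp_idx s = comp_idx s by [].
Qed.

Lemma comp_neq s t : comp_idx s <> comp_idx t -> s != t /\ M s t = Some 2.
Proof.
move=> st; have nst : s != t by apply: contra_not_neq st => ->.
split=> //; case E: (M s t) => [n|].
  have n2 := m_gt1 nst E; congr Some; apply/eqP; rewrite eqn_leq n2 andbT leqNgt.
  apply: contra_notN st => n3; apply/esym/GamE.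
  have /GamE/Gam_component -> : comp_idx s = comp_idx s by [].
  by exists [:: t] => //=; rewrite /cox_edge nst E n3.
exfalso; apply: st; apply/esym/GamE.
have /GamE/Gam_component -> : comp_idx s = comp_idx s by [].
by exists [:: t] => //=; rewrite /cox_edge nst E.
Qed.

(** * Projections onto the factors of the direct product *)

Definition pr_gen (i : 'I_k) (x : va_gen S) : VA M :=
  match x with
  | inl s => if comp_idx s == i then sigma M s else 1
  | inr s => if comp_idx s == i then tau M s else 1
  end.

Lemma lprod_altE (G : groupType) (f : S -> G) s t n :
  lprod f (alt s t n) = foldr (fun x h => x * h) 1 (alt (f s) (f t) n).
Proof. by rewrite -map_alt; elim: (alt s t n) => //= x l ->. Qed.

Lemma pr_rel i u v : va_rel M u v -> word_val (pr_gen i) u = word_val (pr_gen i) v.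
Proof.
have two s t n : M s t = Some n -> (comp_idx s == i) != (comp_idx t == i) -> n = 2.
  move=> mst e; have [|_] := @comp_neq s t; last by rewrite mst => -[].
  by move=> st; rewrite st eqxx in e.
apply: va_hom_rel => [s t n st mst|s t n st mst|s|s t n st mst] /=.
- have := two _ _ _ mst; case: (comp_idx s == i); case: (comp_idx t == i) => /=.
  + by move=> _; exact: sigma_braid.
  + by move=> -> //=; rewrite !mulg1 !mul1g.
  + by move=> -> //=; rewrite !mulg1 !mul1g.
  + by [].
- have := two _ _ _ mst; case: (comp_idx s == i); case: (comp_idx t == i) => /=.
  + by move=> _; exact: tau_braid.
  + by move=> -> //=; rewrite !mulg1 !mul1g.
  + by move=> -> //=; rewrite !mulg1 !mul1g.
  + by [].
- by case: eqP => _; rewrite ?tau_sq ?mulg1.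
- have := two _ _ _ mst; have := sigma_tau_mix st mst; rewrite !lprod_altE /=.
  rewrite (fun_if comp_idx) (fun_if (eq_op^~ i)).
  case: (comp_idx s == i); case: (comp_idx t == i) => /=.
  + by move=> -> _; rewrite if_same.
  + by move=> _ -> //=; rewrite !mulg1 !mul1g.
  + by move=> _ -> //=; rewrite !mulg1 !mul1g.
  + by move=> _ _; rewrite if_same mul1g mulg1.
Qed.

Definition pr i : VA M -> VA M := pres_hom (@pr_rel i).

Lemma prM i : {morph pr i : g h / g * h}. Proof. exact: pres_homM. Qed.
Lemma pr_va_gen i x : pr i (gen (va_rel M) x) = pr_gen i x.
Proof. exact: pres_hom_gen. Qed.
Lemma pr1 i : pr i 1 = 1. Proof. exact: morph_group1 (@prM i). Qed.
Lemma prV i g : pr i g^-1 = (pr i g)^-1. Proof. exact: morph_groupV (@prM i) g. Qed.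

Lemma commute_hom (H : groupType) (f : VA M -> H) z : {morph f : g h / g * h} ->
  (forall x, commute z (f (gen (va_rel M) x))) -> forall g, commute z (f g).
Proof.
move=> fM zf; apply: pres_ind => [|x g IH|x g IH].
- by rewrite (morph_group1 fM); exact: commute1.
- by rewrite fM; exact: commuteM.
- by rewrite fM (morph_groupV fM); apply: commuteM => //; exact: commuteV.
Qed.

Lemma pr_commute i j g h : i != j -> commute (pr i g) (pr j h).
Proof.
move=> ij; have gens x y : commute (pr_gen i x) (pr_gen j y).
  have ne s t : comp_idx s == i -> comp_idx t == j -> comp_idx s <> comp_idx t.
    by move=> /eqP -> /eqP -> /eqP; exact/negP.
  have ss s t : comp_idx s <> comp_idx t -> commute (sigma M s) (sigma M t).
    by move=> /comp_neq[st mst]; have := sigma_braid st mst; rewrite /= !mulg1.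
  have tt s t : comp_idx s <> comp_idx t -> commute (tau M s) (tau M t).
    by move=> /comp_neq[st mst]; have := tau_braid st mst; rewrite /= !mulg1.
  have ts s t : comp_idx s <> comp_idx t -> commute (tau M s) (sigma M t).
    by move=> /comp_neq[st mst]; have := sigma_tau_mix st mst; rewrite /= !mulg1.
  case: x y => s [] t /=; (case: ifP => si; last exact/commute_sym/commute1);
    (case: ifP => tj; last exact: commute1); have st := ne _ _ si tj.
  - exact: ss.
  - exact/commute_sym/ts/nesym.
  - exact: ts.
  - exact: tt.
apply: (commute_hom (@prM j)) => y; apply: commute_sym.
apply: (commute_hom (@prM i)) => x; apply: commute_sym.
by rewrite !pr_va_gen.
Qed.

Lemma prod_single (G : groupType) (I : eqType) (l : seq I) i (x : G) : uniq l ->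
  \prod_(j <- l) (if i == j then x else 1) = if i \in l then x else 1.
Proof.
elim: l => [_|j l IH /= /andP[jl ul]]; first by rewrite big_nil.
rewrite big_cons IH // inE; case: eqP => [->|_] /=; last by rewrite mul1g.
by rewrite (negPf jl) mulg1.
Qed.

Lemma prod_pr g : \prod_(i < k) pr i g = g.
Proof.
have prodM (l : seq 'I_k) : uniq l -> {morph (fun g => \prod_(i <- l) pr i g) : g h / g * h}.
  elim: l => [_|i l IH /= /andP[il ul]] x y; first by rewrite !big_nil mulg1.
  rewrite !big_cons prM IH // !mulgA; congr (_ * _); rewrite -!mulgA; congr (_ * _).
  rewrite big_seq; apply: commute_prod => j jl; apply: pr_commute.
  by apply: contraNneq il => ->.
apply: (pres_hom_ext (f := fun g => \prod_(i < k) pr i g) (g := id)) => //.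
  by apply: prodM; exact: index_enum_uniq.
move=> x; under eq_bigr => i _ do rewrite pr_va_gen.
by case: x => s /=; rewrite prod_single ?index_enum_uniq ?mem_index_enum.
Qed.

Lemma pr_pr i j g : pr i (pr j g) = if i == j then pr i g else 1.
Proof.
have gens x : pr i (pr_gen j x) = if i == j then pr_gen i x else 1.
  case: x => s /=; case: ifP => sj; rewrite ?pr1.
  - rewrite (pr_va_gen i (inl s)) /=; case: (eqVneq i j) => [->//|].
    by rewrite -(eqP sj) eq_sym => /negPf ->.
  - by case: ifP => // /eqP ->; rewrite sj.
  - rewrite (pr_va_gen i (inr s)) /=; case: (eqVneq i j) => [->//|].
    by rewrite -(eqP sj) eq_sym => /negPf ->.
  - by case: ifP => // /eqP ->; rewrite sj.
apply: (pres_hom_ext (f := pr i \o pr j) (g := fun g => if i == j then pr i g else 1)).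
- by move=> x y /=; rewrite !prM.
- by move=> x y; case: ifP; rewrite ?prM ?mulg1.
- by move=> x /=; rewrite !pr_va_gen gens.
Qed.

Lemma pr_self i g : (forall j, j != i -> pr j g = 1) -> pr i g = g.
Proof.
move=> gi; rewrite -[RHS]prod_pr.
rewrite (eq_bigr (fun j => if i == j then pr i g else 1)).
  by rewrite prod_single ?index_enum_uniq ?mem_index_enum.
by move=> j _; case: eqP => [->//|/eqP]; rewrite eq_sym => /gi.
Qed.

Lemma pr_ker_commute i g h : pr i g = 1 -> commute g (pr i h).
Proof.
move=> gi; rewrite -[g]prod_pr; apply/commute_sym/commute_prod => j _.
have [->|ji] := eqVneq j i; first by rewrite gi; exact: commute1.
by apply: pr_commute; rewrite eq_sym.
Qed.

Lemma pr_conj i g h : pr i g = g -> pr i (g ^ h) = g ^ h.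
Proof.
move=> gi; apply: pr_self => j ji.
rewrite (morph_groupJ (@prM j)) -gi pr_pr (negPf ji).
by rewrite conj1g.
Qed.

Lemma VA_subP i g : VA_sub M (Gam i) g <-> pr i g = g.
Proof.
split.
  move=> h; apply: (h [set g | pr i g = g]); split.
    split=> /= [|x y xi yi|x xi]; first exact: pr1.
      by rewrite prM xi yi.
    by rewrite prV xi.
  move=> _ [] [s /GamE si <-] /=.
    by rewrite (pr_va_gen i (inl s)) /= si eqxx.
  by rewrite (pr_va_gen i (inr s)) /= si eqxx.
move=> <- X [[X1 XM XV] GX].
have Xg x : X (pr_gen i x).
  case: x => s /=; case: eqP => // si; apply: GX; [left|right];
    by exists s => //; exact/GamE.
apply: (@pres_ind _ (va_rel M) (fun g => X (pr i g))) => [|x h Xh|x h Xh].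
- by rewrite pr1.
- by rewrite prM pr_va_gen; exact: XM.
- by rewrite prM prV pr_va_gen; apply: XM => //; exact: XV.
Qed.

Definition root_in i (b : va_root M) := exists w s, comp_idx s = i /\ b = root_act w (simple_root M s).

Lemma root_in_ex b : exists i, root_in i b.
Proof. by have [w [s ->]] := root_simple b; exists (comp_idx s), w, s. Qed.

Lemma pr_delta i b : root_in i b -> pr i (delta b) = delta b.
Proof.
case=> w [s [si ->]]; rewrite delta_ract delta_simple; apply: pr_conj.
by rewrite (pr_va_gen i (inl s)) /= si eqxx.
Qed.

Lemma pr_delta_neq i j b : root_in j b -> i != j -> pr i (delta b) = 1.
Proof. by move=> /pr_delta <- ij; rewrite pr_pr (negPf ij). Qed.

Lemma pr_kappa i a : exists2 a' : A, gen_by (root_in i) a' & pr i (kappa a) = kappa a'.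
Proof.
have gens b : exists2 a' : A, gen_by (root_in i) a' & pr i (delta b) = kappa a'.
  have [j jb] := root_in_ex b; have [ij|ij] := eqVneq i j.
    exists (sg b); first by apply: gen_by_gen; rewrite ij.
    by rewrite kappa_gen; apply: pr_delta; rewrite ij.
  exists 1; first exact: gen_by1.
  by rewrite (pr_delta_neq jb ij) (morph_group1 (@kappaM _ _)).
elim/(@pres_ind _ (artin_rel (mhat (M := M)))): a => [|b a [a1 g1 e1]|b a [a1 g1 e1]].
- by exists 1; [exact: gen_by1|rewrite (morph_group1 (@kappaM _ _)) pr1].
- have [a2 g2 e2] := gens b; exists (a2 * a1); first exact: gen_byM.
  by rewrite !kappaM prM e1 kappa_gen e2.
- have [a2 g2 e2] := gens b; exists (a2^-1 * a1).
    by apply: gen_byM => //; exact: gen_byV.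
  by rewrite !kappaM prM !(morph_groupV (@kappaM _ _)) prV e1 kappa_gen e2.
Qed.

(** The projection commutes with [delta b] for roots of component [i] by hypothesis, and for the
    other roots because distinct factors commute; so it centralizes K. *)
Lemma pr_centralizer i h : (forall b, root_in i b -> commute h (delta b)) -> pr i h = 1.
Proof.
move=> hi; apply: centralizer_kappa => b.
have [j jb] := root_in_ex b; have [ij|ij] := eqVneq j i.
  move: jb; rewrite {j}ij => ib; rewrite -(pr_delta ib) -!prM.
  by congr pr; exact: hi.
by rewrite -(pr_delta jb); apply: pr_commute; rewrite eq_sym.
Qed.

(** * Connectedness of the graph of infinite labels *)

Inductive linked (b : va_root M) : va_root M -> Prop :=
  | Linked_refl : linked b b
  | Linked_step c d : linked b c -> c <> d -> mhat c d = None -> linked b d.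

Lemma linked_trans b c d : linked b c -> linked c d -> linked b d.
Proof. by move=> bc; elim=> // x y _ bx xy mxy; exact: Linked_step bx xy mxy. Qed.

Lemma linked_sym b c : linked b c -> linked c b.
Proof.
elim=> [|x y _ xb xy mxy]; first exact: Linked_refl.
apply: linked_trans xb; apply: (Linked_step (Linked_refl y)); first exact: nesym.
by rewrite mhat_sym.
Qed.

Lemma linked_ract w b c : linked b c -> linked (root_act w b) (root_act w c).
Proof.
elim=> [|x y _ bx xy mxy]; first exact: Linked_refl.
by apply: (Linked_step bx) => [/root_act_inj//|]; rewrite mhat_ract.
Qed.

Lemma linked_opp b : linked b (opp_root b).
Proof.
apply: (Linked_step (Linked_refl b)); last exact: mhat_opp.
exact/nesym/opp_neq.
Qed.

(** An edge of the Coxeter graph labeled infinity is a link itself. For a finite label at least 3,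
    alpha_s is linked to -alpha_x by [mhat_obtuse], and -alpha_x to alpha_x. *)
Lemma linked_simple s t : comp_idx s = comp_idx t -> linked (simple_root M s) (simple_root M t).
Proof.
case/comp_path=> p; elim: p s => [|x p IH] s /=; first by move=> _ ->; exact: Linked_refl.
case/andP=> sx xp tp; apply: linked_trans (IH _ xp tp).
have /andP[nsx] := sx; case E: (M s x) => [n|] => n3; last first.
  apply: (Linked_step (Linked_refl _)); last by rewrite mhat_simple.
  by move/simple_inj => e; rewrite e eqxx in nsx.
apply: (linked_trans (c := opp_root (simple_root M x))); last exact/linked_sym/linked_opp.
apply: (Linked_step (Linked_refl _)); last exact: mhat_obtuse nsx E n3.
by move/(congr1 val); case=> _ _; rewrite rgenV par_gen eqxx.
Qed.

(** Induction on a word for w: if [t] is in the component of [s], then alpha_s, alpha_t, -alpha_t =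
    t alpha_t and t alpha_s are successively linked; otherwise [t] fixes alpha_s. *)
Lemma linked_root i b c : root_in i b -> root_in i c -> linked b c.
Proof.
suff E w s : linked (simple_root M s) (root_act w (simple_root M s)).
  case=> w [s [si ->]] [v [t [ti ->]]].
  apply: (linked_trans (linked_sym (E w s))); apply: linked_trans (E v t).
  by apply: linked_simple; rewrite si ti.
have [u ->] := cword_surj w; elim: u => [|t u IH]; first by rewrite ract1; exact: Linked_refl.
rewrite ractM; apply: linked_trans (linked_ract (r t) IH).
have [st|/eqP st] := eqVneq (comp_idx s) (comp_idx t); last first.
  by have [_ mst] := comp_neq st; rewrite ract_commute //; exact: Linked_refl.
apply: (linked_trans (linked_simple st)); apply: (linked_trans (linked_opp _)).
by rewrite opp_simple; apply/linked_ract/linked_simple.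
Qed.

Lemma linked_live (N : A -> Prop) b c : (forall g h, N g -> N (g ^ h)) -> linked b c ->
  (exists2 n, N n & ~ gen_by (fun z => z <> b) n) ->
  exists2 n, N n & ~ gen_by (fun z => z <> c) n.
Proof.
move=> NJ bc live; elim: bc => // x y _ [n Nn nn] xy mxy.
exact: (normal_transfer h_sym h_gt1 xy mxy NJ Nn nn).
Qed.

(** * The action of an automorphism on the factors *)

Section Automorphism.
Variable phi : group_aut (VA M).

Let phiM : {morph phi : g h / g * h}. Proof. exact: gmulfM. Qed.

Let phi_surj g : exists h, g = phi h.
Proof. by have [psi _ phiK] := aut_bij phi; exists (psi g). Qed.

Let phi_inj : injective phi. Proof. exact: bij_inj (aut_bij phi). Qed.

(* The preimage of phi(VA[Gamma_j]) under [kappa]. *)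
Definition aut_trace j (a : A) := exists2 g, pr j g = g & kappa a = phi g.

Lemma traceV j a : aut_trace j a -> aut_trace j a^-1.
Proof.
case=> g gj e; exists g^-1; first by rewrite prV gj.
by rewrite (morph_groupV (@kappaM _ _)) e (morph_groupV phiM).
Qed.

Lemma traceJ j a b : aut_trace j a -> aut_trace j (a ^ b).
Proof.
case=> g gj e; have [h hb] := phi_surj (kappa b); exists (g ^ h); first exact: pr_conj.
by rewrite (morph_groupJ (@kappaM _ _)) (morph_groupJ phiM) e hb.
Qed.

Definition sees i j := exists g, pr i (phi (pr j g)) <> 1.

Lemma sees_trace i j : sees i j -> exists2 b, root_in i b &
  exists2 n, aut_trace j n & ~ gen_by (fun z => z <> b) n.
Proof.
case=> g gi; set h := phi (pr j g) in gi.
have [b ib hb] : exists2 b, root_in i b & ~ commute h (delta b).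
  apply: contrapT => no; apply: gi; apply: pr_centralizer => b ib.
  by apply: contrapT => nb; apply: no; exists b.
(* This commutator lies at once in K, in the factor of component [i] and in the image of factor [j],
   all of which are normal. *)
pose x := h^-1 * h ^ delta b.
have [n xn] : exists n, x = kappa n.
  apply: piK1; rewrite piKM (morph_groupV (@piKM _ _)) (morph_groupJ (@piKM _ _)).
  by rewrite -kappa_gen piK_kappa conjg1 mulVg.
have xi : pr i x = x.
  rewrite /x conjgE !mulgA prM; have ib' := pr_delta ib; rewrite ib'; congr (_ * _).
  have -> : h^-1 * (delta b)^-1 * h = (delta b)^-1 ^ h by rewrite conjgE mulgA.
  by apply: pr_conj; rewrite prV ib'.
have [n' in' en'] := pr_kappa i n.
have nn' : n = n' by apply: kappa_inj; rewrite -en' -xn xi.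
have n1 : n <> 1.
  move=> n1; apply: hb; move: xn; rewrite n1 (morph_group1 (@kappaM _ _)) /x conjgE => e.
  have {e}e : (delta b)^-1 * (h * delta b) = h.
    by rewrite -[RHS]mulg1 -e mulVKg.
  by rewrite /commute -{2}e mulVKg.
have [y yi ny] : exists2 y, root_in i y & ~ gen_by (fun z => z <> y) n.
  by apply: (gen_by_neq1 h_sym h_gt1) n1; rewrite nn'.
exists y => //; exists n => //.
have [d db] := phi_surj (delta b).
exists ((pr j g)^-1 * pr j g ^ d).
  by rewrite prM prV pr_conj pr_pr eqxx.
by rewrite -xn /x /h db phiM (morph_groupV phiM) (morph_groupJ phiM).
Qed.

Lemma sees_uniq i j j' : sees i j -> sees i j' -> j = j'.
Proof.
move=> /sees_trace[b ib [n Nn nn]] /sees_trace[b' ib' live'].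
apply/eqP; apply: contraT => jj'.
have [n' Nn' nn'] := linked_live (@traceJ j') (linked_root ib' ib) live'.
have bb' : b <> opp_root b by apply: nesym; exact: opp_neq.
have := @commuting_normal _ _ h_sym h_gt1 b (opp_root b) bb' (mhat_opp b) (aut_trace j) (aut_trace j')
  n n' (@traceV j) (@traceJ j) (@traceV j') (@traceJ j') _ Nn Nn'.
case=> // [x y [g gj ex] [h hj ey]|[_ en]|[_ en]] //.
apply: kappa_inj; rewrite !kappaM ex ey -!phiM; congr (phi _).
by rewrite -gj -hj; exact: pr_commute.
Qed.

Lemma sigma_neq1 s : sigma M s <> 1.
Proof.
rewrite -delta_simple -kappa_gen -(morph_group1 (@kappaM _ _)) => /kappa_inj e.
by move/eqP: (@sgen_sq_neq1 _ (mhat (M := M)) (simple_root M s)); rewrite e mulg1.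
Qed.

Lemma sees_ex i : exists j, sees i j.
Proof.
apply: contrapT => no; have [s si] := comp_surj i; apply: (@sigma_neq1 s).
have [g gs] := phi_surj (sigma M s).
have <- : pr i (sigma M s) = sigma M s.
  by rewrite (pr_va_gen i (inl s)) /= si eqxx.
have prphi1 j : pr i (phi (pr j g)) = 1.
  by apply: contrapT => h; apply: no; exists j, g.
rewrite gs -[g]prod_pr.
apply: (big_ind (fun x => pr i (phi x) = 1)) => [|x y hx hy|j _] //.
  by rewrite (morph_group1 phiM) pr1.
by rewrite phiM prM hx hy mulg1.
Qed.

Lemma component_preimage i : exists j, forall h, pr i (phi h) = phi h -> pr j h = h.
Proof.
have [j ij] := sees_ex i; exists j => h hi; apply: pr_self => j' jj'.
apply: pr_centralizer => b jb; apply: phi_inj; rewrite !phiM.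
rewrite -hi; apply/esym/pr_ker_commute.
apply: contrapT => no; move/eqP: jj'; apply; apply: (sees_uniq (i := i)) => //.
by exists (delta b); rewrite pr_delta.
Qed.

End Automorphism.

Lemma pr_sub_eq i j : (forall g, pr i g = g -> pr j g = g) -> i = j.
Proof.
move=> ij; apply/eqP; apply: contraT => nij.
have [s si] := comp_surj i; case: (@sigma_neq1 s).
have es : pr i (sigma M s) = sigma M s.
  by rewrite (pr_va_gen i (inl s)) /= si eqxx.
by rewrite -(ij _ es) -es pr_pr eq_sym (negPf nij).
Qed.

Lemma aut_component (phi : group_aut (VA M)) i : exists j,
  phi @` VA_sub M (Gam i) = VA_sub M (Gam j).
Proof.
have [psi [psiK phiK]] := aut_inv_subproof phi.
have [j hj] := component_preimage psi i.
have [i' hi'] := component_preimage phi j.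
have sub g : pr i g = g -> pr j (phi g) = phi g.
  by move=> gi; apply: hj; rewrite psiK.
(* The inclusions for the inverse automorphism and for [phi] compose to an inclusion of factor [i]
   in factor [i']; distinct factors meet trivially and none is trivial. *)
have ii' : i = i' by apply: pr_sub_eq => g /sub /hi'.
exists j; apply/seteqP; split=> [_ [g /VA_subP gi <-]|g /VA_subP gj].
  exact/VA_subP/sub.
exists (psi g); last by rewrite phiK.
by apply/VA_subP; rewrite ii'; apply: hi'; rewrite phiK.
Qed.

Lemma VA_sub_inj i j : VA_sub M (Gam i) = VA_sub M (Gam j) -> i = j.
Proof. by move=> e; apply: pr_sub_eq => g /VA_subP; rewrite e => /VA_subP. Qed.

Definition aut_index (phi : group_aut (VA M)) i : 'I_k := projT1 (cid (aut_component phi i)).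

Lemma aut_indexP (phi : group_aut (VA M)) i : phi @` VA_sub M (Gam i) = VA_sub M (Gam (aut_index phi i)).
Proof. by rewrite /aut_index; case: cid. Qed.

Lemma aut_index_inj (phi : group_aut (VA M)) : injective (aut_index phi).
Proof.
move=> i j /(congr1 (fun i => VA_sub M (Gam i))); rewrite -!aut_indexP => e.
have phi_inj : injective phi by exact: bij_inj (aut_bij phi).
apply: VA_sub_inj; apply/seteqP; split=> g gi.
  have : (phi @` VA_sub M (Gam i)) (phi g) by exists g.
  by rewrite e => -[h hj /phi_inj <-].
have : (phi @` VA_sub M (Gam j)) (phi g) by exists g.
by rewrite -e => -[h hj /phi_inj <-].
Qed.

Definition aut_perm (phi : group_aut (VA M)) : 'S_k := perm (@aut_index_inj phi).

Lemma aut_permM : {morph aut_perm : phi psi / phi * psi}.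
Proof.
move=> phi psi; apply/permP => i; rewrite permM !permE; apply: VA_sub_inj.
by rewrite -!aut_indexP -image_comp.
Qed.

End Components.

Local Open Scope classical_set_scope.

Theorem theorem6p2 (S : countType) (M : coxeter_matrix S) (k : nat)
    (Gam : 'I_k -> set S) (hGam : connected_components M Gam) :
  exists Psi : {multiplicative group_aut (VA M) -> 'S_k},
    forall (phi : group_aut (VA M)) (i : 'I_k),
      phi @` VA_sub M (Gam i) = VA_sub M (Gam (Psi phi i)).
Proof.
pose Psi : {multiplicative group_aut (VA M) -> 'S_k} :=
  HB.pack (aut_perm hGam) (isMultiplicative.Build _ _ _ (aut_permM hGam)).
by exists Psi => phi i; rewrite permE; exact: aut_indexP.
Qed.
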